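(* Assume that for every $n<\omega$, $T$ is $n$-stable over $P$. Let $\langle A_s:s\in I\rangle$ be a good system and let $\lambda=\sum_{s\in I}|A_s|$, with $\lambda>|T|$. Then there are sets $A^s_\alpha$ for $s\in I$, $\alpha<\lambda$, such that: (a) $|A^s_\alpha|\le|\alpha|+|T|$; (b) for each $s$, $\langle A^s_\alpha:\alpha<\lambda\rangle$ is increasing and continuous; (c) for each $\alpha$, $\langle A^s_\alpha:s\in I\rangle\prec\langle A_s:s\in I\rangle$; (d) for each $\alpha$, $\langle A^s_\alpha:s\in I\rangle$ is a good system; (e) letting $J=I\cup\{t\cup\{n_I\}:t\in I\}$ and, for $\alpha<\beta<\lambda$ and $s\in J$, $A^s_{\{\alpha,\beta\}}=A^s_\alpha$ if $s\in I$ and $A^s_{\{\alpha,\beta\}}=A^t_\beta$ if $n_I\in s$ and $t=s\setminus\{n_I\}$, the family $\langle A^s_{\{\alpha,\beta\}}:s\in J\rangle$ is a good system.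
   Context: Setting: $T$ is a complete first-order theory in a vocabulary with no function symbols, with a unary predicate $P$, $T$ implies $P$ is infinite; $\mathcal{C}$ is its monster model, all sets are subsets of $\mathcal{C}$, models are elementary submodels of $\mathcal{C}$; $T$ is Morleyized and sets are identified with induced substructures ($A\equiv A'$ means elementary equivalence of these). $P$ is stably embedded, every subset of $P^{\mathcal{C}}$ definable in $\mathcal{C}$ is definable in the theory $T^P$ of the induced structure $\mathcal{C}^P$ on $P^{\mathcal{C}}$, and every model $M\prec\mathcal{C}$ is stable over $P$. $P^A=A\cap P^{\mathcal{C}}$. Complete set: $A$ such that for all $\psi(\bar x,\bar y)$, $\bar b\subseteq A$, if $\models(\exists\bar x\in P)\psi(\bar x,\bar b)$ then $\models\psi(\bar a,\bar b)$ for some $\bar a\subseteq P\cap A$. For complete $A$, $S_*(A)=\{\mathrm{tp}(\bar c/A): P\cap(A\cup\bar c)=P\cap A,\ A\cup\bar c\text{ complete}\}$; $A$ is stable (over $P$) if $|S_*(A')|\le|A'|^{|T|}$ for all $A'\equiv A$. Notation: $n=\{0,\dots,n-1\}$, $\mathcal{P}(Y)$ power set, $\mathcal{P}^-(Y)=\mathcal{P}(Y)\setminus\{Y\}$. Order $\mathcal{P}(n)$ lexicographically: $s<t$ iff at the least $k\in s\triangle t$ we have $k\in t$. $I$ is weakly nice if for some $n=n_I$, $I\subseteq\mathcal{P}(n)$, $\mathcal{P}(\{1,\dots,n-1\})\subseteq I$, and $I$ is closed under subsets; nice if also an initial segment of $\mathcal{P}(n)$. A presystem $\langle A_s:s\in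 I\rangle$ ($I$ weakly nice) is viewed as a structure with universe $\bigcup_sA_s$, the structure induced from $\mathcal{C}$, and a unary predicate for each $A_s$ (so $\prec$ between presystems refers to these structures). By induction on $n=n_I$ it is a good system if: (i) $I$ is nice; (ii) $A_s\cap A_t=A_{s\cap t}$; (iii) $0\notin s\Rightarrow A_s\prec\mathcal{C}^P$, $0\in s\Rightarrow A_s\prec\mathcal{C}$; (iv) $A_s\cap P^{\mathcal{C}}=A_{s\setminus\{0\}}$; (v) if $n\ge2$, $\langle A_s:s\in\mathcal{P}(\{1,\dots,n-2\})\rangle\prec\langle A_{s\cup\{n-1\}}:s\in\mathcal{P}(\{1,\dots,n-2\})\rangle$ and these are good systems; (vi) $\bigcup_{t\in\mathcal{P}^-(s)}A_t$ is stable whenever $0\in s\in I$; (vii) for every $\phi$ and $\bar b_s\in A_s$ ($s\in I$) with $\models\phi(\dots,\bar b_s,\dots)$ there are $\bar b'_s\in A_{s\setminus\{n-1\}}$ with $\models\phi(\dots,\bar b'_s,\dots)$, and $\bar b'_s=\bar b_s$ can be chosen when $n-1\notin s$; (viii) $\langle A_{s\cup\{n-1\}}:s\in I_{[n-1]}\rangle$ and $\langle A_s:s\in I^{[n-1]}\rangle$ are good systems, where $I^{[n-1]}=\{s\in I:n-1\notin s\}$, $I_{[n-1]}=\{s:n-1\notin s,\ s\cup\{n-1\}\in I\}$. $T$ is $n$-stable over $P$ if for every good system $\langle A_s:s\in\mathcal{P}^-(n)\rangle$ the union $\bigcup_{s\in\mathcal{P}^-(n)}A_s$ is stable over $P$.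
   Formalization: Good systems are taken with n_I ≥ 1, and clauses (vii) and (viii) of their definition are imposed only for n ≥ 2; taken literally at n = 1 they would force A_{0} inside P and elementary in C^P, so that essentially no good systems would exist. *)

(* Defs.v *)
From mathcomp Require Import all_boot finmap.
From mathcomp Require Import boolp classical_sets functions cardinality wochoice.

Set Implicit Arguments.
Unset Strict Implicit.
Unset Printing Implicit Defensive.

Local Open Scope classical_set_scope.
Local Open Scope card_scope.

(* A cardinal is represented by any set, on any type, having that many elements. *)
Definition card_lt (T U : Type) (A : set T) (B : set U) : Prop :=
  A #<= B /\ ~ (B #<= A).

Definition set_sum (T U : Type) (A : set T) (B : set U) : set (T + U) :=
  [set x | match x with inl a => A a | inr b => B b end].

Definition slt (O : Type) (le : rel O) (a b : O) : Prop := le a b /\ a <> b.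

Definition below (O : Type) (le : rel O) (a : O) : set O := [set b | slt le b a].

(* [(O, le)] is a copy of the cardinal number #|A|, i.e. of the least ordinal
   equipotent to [A]; the elements of [O] stand for the ordinals alpha < #|A|,
   and the ordinal alpha itself is [below le alpha]. *)
Definition initial_ordinal (O : Type) (le : rel O) (U : Type) (A : set U) : Prop :=
  [/\ well_order le,
      forall a, card_lt (below le a) [set: O] &
      [set: O] #= A].

Definition limit_point (O : Type) (le : rel O) (d : O) : Prop :=
  (exists a, slt le a d) /\
  forall a, slt le a d -> exists b, slt le a b /\ slt le b d.

Record language : Type := Language {
  relsym : Type;
  arity : relsym -> nat
}.

(* [form L n]: formulas whose free variables are among x_0, ..., x_{n-1}. In
   [fAll f] the quantified variable is variable 0 of [f]. *)
Inductive form (L : language) : nat -> Type :=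
| fFalse n : form L n
| fEq n (i j : 'I_n) : form L n
| fRel n (R : relsym L) (v : 'I_(arity R) -> 'I_n) : form L n
| fImp n (f g : form L n) : form L n
| fAll n (f : form L n.+1) : form L n.

Arguments fFalse {L n}.

Definition fNot (L : language) (n : nat) (f : form L n) : form L n :=
  fImp f fFalse.

(* The universe is a subset [dom] of an ambient type, so that a set inside the
   monster model and the substructure it carries can be identified. The values
   of [interp] outside [dom] are irrelevant. *)
Record structure (L : language) (X : Type) : Type := Structure {
  dom : set X;
  interp : forall R : relsym L, ('I_(arity R) -> X) -> Prop
}.

Definition env0 (X : Type) : 'I_0 -> X :=
  fun i => False_rect X (notF (ltn_ord i)).

Definition env_cons (X : Type) (n : nat) (a : X) (e : 'I_n -> X) : 'I_n.+1 -> X :=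
  fun i => oapp e a (unlift ord0 i).

Definition env_cat (X : Type) (m n : nat) (a : 'I_m -> X) (b : 'I_n -> X) :
    'I_(m + n) -> X :=
  fun i => match fintype.split i with inl j => a j | inr j => b j end.

Definition inside (X : Type) (n : nat) (A : set X) (e : 'I_n -> X) : Prop :=
  forall i, A (e i).

Fixpoint sat (L : language) (X : Type) (M : structure L X) (n : nat)
    (f : form L n) {struct f} : ('I_n -> X) -> Prop :=
  match f in form _ n return ('I_n -> X) -> Prop with
  | fFalse _ => fun _ => False
  | fEq _ i j => fun e => e i = e j
  | fRel _ R v => fun e => interp M (e \o v)
  | fImp _ f g => fun e => sat M f e -> sat M g e
  | fAll _ f => fun e => forall a, dom M a -> sat M f (env_cons a e)
  end.

Definition models (L : language) (X : Type) (M : structure L X)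
    (T : set (form L 0)) : Prop :=
  forall f, T f -> sat M f (@env0 X).

Definition elem_equiv (L : language) (X Y : Type)
    (M : structure L X) (N : structure L Y) : Prop :=
  forall f : form L 0, sat M f (@env0 X) <-> sat N f (@env0 Y).

Definition elem_sub (L : language) (X : Type) (M N : structure L X) : Prop :=
  dom M `<=` dom N /\
  forall (n : nat) (f : form L n) (e : 'I_n -> X),
    inside (dom M) e -> (sat M f e <-> sat N f e).

Definition induced (L : language) (X : Type) (M : structure L X) (A : set X) :
    structure L X :=
  Structure A (@interp L X M).

Definition pred_set (L : language) (P : relsym L) (X : Type)
    (M : structure L X) : set X :=
  [set x | dom M x /\ interp M (fun _ : 'I_(arity P) => x)].

(* Complete theories are taken deductively closed, so that the cardinal #|T| is
   literally the number of sentences of [T], i.e. #|L| + aleph_0. *)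
Definition complete_theory (L : language) (T : set (form L 0)) : Prop :=
  (exists (X : Type) (M : structure L X), dom M !=set0 /\ models M T) /\
  forall f, T f \/ T (fNot f).

(* Arity 0 is left out so that no 0-ary predicate is required; a sentence is
   covered by regarding it as a formula in one variable. *)
Definition Morleyized (L : language) (T : set (form L 0)) : Prop :=
  forall (n : nat) (f : form L n.+1),
    exists (R : relsym L) (h : arity R = n.+1),
    forall (X : Type) (M : structure L X), models M T ->
    forall e : 'I_n.+1 -> X, inside (dom M) e ->
      (sat M f e <-> interp M (e \o cast_ord h)).

Section Monster.

Variables (L : language) (X : Type) (C : structure L X).

(* A formula phi(x, a) in [k] variables x, with a finite tuple a of parameters. *)
Definition pform (k : nat) : Type := {m : nat & (form L (k + m) * ('I_m -> X))%type}.

Definition pform_over (k : nat) (A : set X) (p : pform k) : Prop :=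
  inside A (tagged p).2.

Definition realizes (k : nat) (c : 'I_k -> X) (p : pform k) : Prop :=
  sat C (tagged p).1 (env_cat c (tagged p).2).

Definition tp (k : nat) (c : 'I_k -> X) (A : set X) : set (pform k) :=
  [set p | pform_over A p /\ realizes c p].

Definition small (K : Type) (A : set X) : Prop := card_lt A [set: K].

Definition saturated (K : Type) : Prop :=
  forall (A : set X) (p : set (pform 1)), small K A -> p `<=` pform_over A ->
    (forall q, finite_set q -> q `<=` p -> exists c, q `<=` realizes c) ->
    exists c, p `<=` realizes c.

Definition automorphism (g : X -> X) : Prop :=
  bijective g /\
  forall (R : relsym L) (e : 'I_(arity R) -> X), interp C (g \o e) <-> interp C e.

Definition strongly_homogeneous (K : Type) : Prop :=
  forall (A : set X) (h : X -> X), small K A ->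
    (forall (n : nat) (f : form L n) (e : 'I_n -> X), inside A e ->
       (sat C f e <-> sat C f (h \o e))) ->
    exists g, automorphism g /\ forall x, A x -> g x = h x.

(* The cardinal #|K| is the degree of saturation of the monster model; the sets
   considered are those of cardinality < #|K|. *)
Definition monster (T : set (form L 0)) (K : Type) : Prop :=
  [/\ dom C = setT, models C T, card_lt T [set: K],
      saturated K & strongly_homogeneous K].

Definition stably_embedded (P : relsym L) : Prop :=
  forall (k m : nat) (f : form L (k + m)) (c : 'I_m -> X),
    exists (l : nat) (g : form L (k + l)) (d : 'I_l -> X),
      inside (pred_set P C) d /\
      forall a : 'I_k -> X, inside (pred_set P C) a ->
        (sat C f (env_cat a c) <-> sat C g (env_cat a d)).

Definition definable_in_TP (P : relsym L) : Prop :=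
  forall (k : nat) (f : form L k), exists g : form L k,
    forall a : 'I_k -> X, inside (pred_set P C) a ->
      (sat C f a <-> sat (induced C (pred_set P C)) g a).

Definition equiv_sets (A B : set X) : Prop :=
  elem_equiv (induced C A) (induced C B).

Definition elem_submodel (A : set X) : Prop := elem_sub (induced C A) C.

Definition elem_submodel_P (P : relsym L) (A : set X) : Prop :=
  elem_sub (induced C A) (induced C (pred_set P C)).

Definition complete_set (P : relsym L) (A : set X) : Prop :=
  forall (k m : nat) (f : form L (k + m)) (b : 'I_m -> X), inside A b ->
    (exists a, inside (pred_set P C) a /\ sat C f (env_cat a b)) ->
    exists a, inside (pred_set P C `&` A) a /\ sat C f (env_cat a b).

Definition S_star (P : relsym L) (A : set X) : set {k : nat & set (pform k)} :=
  [set p | exists (k : nat) (c : 'I_k -> X),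
     [/\ pred_set P C `&` (A `|` range c) = pred_set P C `&` A,
         complete_set P (A `|` range c) &
         p = existT _ k (tp c A)]].

(* S_*(A), hence stability, is only considered for complete [A]. Completeness of
   [A'] then follows from elementary equivalence, as T is Morleyized. The
   cardinal #|A'| ^ #|T| is that of the function type [T -> A']. *)
Definition stable (P : relsym L) (T : set (form L 0)) (K : Type) (A : set X) : Prop :=
  complete_set P A /\
  forall A' : set X, small K A' -> equiv_sets A' A ->
    S_star P A' #<= [set: set_type T -> set_type A'].

Record setting (P : relsym L) (T : set (form L 0)) (K : Type) : Prop := Setting {
  setting_arity : arity P = 1;
  setting_complete : complete_theory T;
  setting_infinite : forall (Y : Type) (M : structure L Y),
    models M T -> dom M !=set0 -> infinite_set (pred_set P M);
  setting_Morleyized : Morleyized T;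
  setting_monster : monster T K;
  setting_embedded : stably_embedded P;
  setting_definable : definable_in_TP P;
  setting_stable : forall M : set X,
    small K M -> elem_submodel M -> stable P T K M
}.

Definition nset (n : nat) : {fset nat} := [fset k in iota 0 n]%fset.

(* {1, ..., n-1} *)
Definition nset1 (n : nat) : {fset nat} := [fset k in iota 1 n.-1]%fset.

Definition power (s : {fset nat}) : set {fset nat} := [set t | (t `<=` s)%fset].

Definition power_minus (s : {fset nat}) : set {fset nat} := [set t | (t `<` s)%fset].

Definition lex_lt (s t : {fset nat}) : Prop :=
  exists k, [/\ k \in t, k \notin s & forall j, j < k -> (j \in s) = (j \in t)].

(* The number n_I is given explicitly; as n_I >= 1 it is determined by [I]. *)
Definition weakly_nice (n : nat) (I : set {fset nat}) : Prop :=
  [/\ 0 < n, I `<=` power (nset n), power (nset1 n) `<=` I &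
      forall s t, I s -> (t `<=` s)%fset -> I t].

Definition nice (n : nat) (I : set {fset nat}) : Prop :=
  weakly_nice n I /\ forall s t, I s -> power (nset n) t -> lex_lt t s -> I t.

(* I^{[m]}, resp. I_{[m]} *)
Definition index_without (m : nat) (I : set {fset nat}) : set {fset nat} :=
  [set s | I s /\ m \notin s].

Definition index_with (m : nat) (I : set {fset nat}) : set {fset nat} :=
  [set s | m \notin s /\ I (m |` s)%fset].

Definition system_language (I : set {fset nat}) : language :=
  @Language (relsym L + {s : {fset nat} | I s})
    (fun R => match R with inl R => arity R | inr _ => 1 end).

Definition system_structure (I : set {fset nat}) (A : {fset nat} -> set X) :
    structure (system_language I) X :=
  @Structure (system_language I) X (\bigcup_(s in I) A s)
    (fun R => match R return ('I_(@arity (system_language I) R) -> X) -> Prop with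
              | inl R => fun e => @interp L X C R e
              | inr s => fun e => A (sval s) (e ord0)
              end).

(* A family indexed by [I] is a function on all finite sets of naturals whose
   values outside [I] are irrelevant. *)
Definition system_elem_sub (I : set {fset nat}) (A B : {fset nat} -> set X) : Prop :=
  elem_sub (system_structure I A) (system_structure I B).

(* Smallness is the convention that all sets considered have size < #|K|. *)
Definition good_base (P : relsym L) (T : set (form L 0)) (K : Type)
    (n : nat) (I : set {fset nat}) (A : {fset nat} -> set X) : Prop :=
  [/\ nice n I,
      (forall s, I s -> small K (A s)),
      (forall s t, I s -> I t -> A s `&` A t = A (s `&` t)%fset),
      (forall s, I s ->
         (0 \notin s -> elem_submodel_P P (A s)) /\
         (0 \in s -> elem_submodel (A s))) &
      (forall s, I s -> A s `&` pred_set P C = A (s `\ 0)%fset) /\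
      (forall s, I s -> 0 \in s ->
         stable P T K (\bigcup_(t in power_minus s) A t))].

(* The tuples b_s, s in I, are listed as one tuple [b] whose i-th entry is part
   of b_{u i}; here m = n - 1. *)
Definition reflects_down (m : nat) (I : set {fset nat}) (A : {fset nat} -> set X) :
    Prop :=
  forall (k : nat) (f : form L k) (u : 'I_k -> {fset nat}) (b : 'I_k -> X),
    (forall i, I (u i) /\ A (u i) (b i)) -> sat C f b ->
    exists b' : 'I_k -> X,
      [/\ forall i, A (u i `\ m)%fset (b' i),
          forall i, m \notin u i -> b' i = b i &
          sat C f b'].

(* The clauses mentioning n - 1 (= m below) are imposed for n >= 2 only: for
   n = 1 they would speak of n - 1 = 0, and e.g. require A_{0} to be elementary
   in C^P as soon as {0} is in [I]. *)
Fixpoint good_system (P : relsym L) (T : set (form L 0)) (K : Type)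
    (n : nat) (I : set {fset nat}) (A : {fset nat} -> set X) {struct n} : Prop :=
  match n with
  | 0 => False
  | m.+1 =>
    good_base P T K m.+1 I A /\
    (0 < m ->
     let above := fun s => A (m |` s)%fset in
     [/\ [/\ system_elem_sub (power (nset1 m)) A above,
             good_system P T K m (power (nset1 m)) A &
             good_system P T K m (power (nset1 m)) above],
         reflects_down m I A,
         good_system P T K m (index_with m I) above &
         good_system P T K m (index_without m I) A])
  end.

Definition n_stable (P : relsym L) (T : set (form L 0)) (K : Type) (n : nat) : Prop :=
  forall A : {fset nat} -> set X,
    good_system P T K n (power_minus (nset n)) A ->
    stable P T K (\bigcup_(s in power_minus (nset n)) A s).

End Monster.

(* The disjoint union of the A_s, s in I; its cardinal is the sum of the #|A_s|. *)
Definition disjoint_union (X : Type) (I : set {fset nat}) (A : {fset nat} -> set X) :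
    set ({fset nat} * X) :=
  [set p | I p.1 /\ A p.1 p.2].

Definition index_double (n : nat) (I : set {fset nat}) : set {fset nat} :=
  I `|` [set (n |` t)%fset | t in I].

Definition pair_system (X : Type) (n : nat) (A B : {fset nat} -> set X) :
    {fset nat} -> set X :=
  fun s => if n \in s then B (s `\ n)%fset else A s.

(* Main.v *)
(* The set B_a s is the trace on A_s of the Skolem hull, in the structure carried
   by the whole system, of its first a elements. Hulls are finitary, hence
   increasing and continuous in a, and of size at most |a| + |T|. Elementarity of
   B_a in A transfers each clause of goodness, stability being invariant under
   elementary equivalence by definition. For the pair (B_a, B_b), elementarity of
   B_a in B_b is exactly the reflection clause for the new index n; the one clause
   not inherited is the stability of the union over the proper subsets of some
   s with 0, n in s. After the elements of s are enumerated increasingly, these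
   proper subsets become those of #|s|, the resulting system is good by induction
   on #|s|, and #|s|-stability of T applies. *)

Require Import Defs.
From mathcomp Require Import all_boot finmap.
From mathcomp Require Import boolp classical_sets functions cardinality wochoice.

Set Implicit Arguments.
Unset Strict Implicit.
Unset Printing Implicit Defensive.

Local Open Scope classical_set_scope.
Local Open Scope card_scope.

(** * Cardinals *)

(** Elementarity between systems concerns truth in the structure that a system carries, whereas
    completeness and the reflection clause concern truth in [C], where quantifiers range over a
    larger universe. Morleyization closes the gap: a formula evaluated in [C] is equivalent to a
    relation symbol, and an atomic formula has the same truth value in [C] and in every induced
    structure. Each of these conditions then becomes a first-order statement about the system, with
    quantifiers bounded by its finitely many parts.

    The bound on the size of a hull is a count of Skolem terms. A term is a finite word over
    generators and formulas, so the disjoint union of the generators and [T] must absorb its own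
    finite words; this is why an injection of [seq U] into [U] is built for every infinite [U].
    Completeness of [T] is what lets [T] bound the vocabulary: of each sentence and its negation one
    belongs to [T], which gives room for all relation symbols and for the natural numbers. *)

Definition inj_into (U V : Type) (A : set U) (B : set V) (g : U -> V) : Prop :=
  (forall x, A x -> B (g x)) /\ (forall x y, A x -> A y -> g x = g y -> x = y).

(** Comparability of cardinals, by Zorn's lemma on graphs of partial injections. If a maximal graph
    missed a point on each side, that pair could be added to it. *)
Lemma inj_into_total (U V : Type) (u0 : U) (v0 : V) (A : set U) (B : set V) :
  (exists g, inj_into A B g) \/ (exists g, inj_into B A g).
Proof.
pose Q := [set G : set (U * V) | [/\ forall p, G p -> A p.1 /\ B p.2,
  forall p q, G p -> G q -> p.1 = q.1 -> p.2 = q.2 &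
  forall p q, G p -> G q -> p.2 = q.2 -> p.1 = q.1]].
have [F FQ Ftot|G [[GAB Gfun Ginj] Gmax]] := @Zorn_bigcup _ Q.
  have two p q : (\bigcup_(G in F) G) p -> (\bigcup_(G in F) G) q ->
      exists2 G, F G & G p /\ G q.
    move=> [G FG Gp] [H FH Hq]; have [GH|HG] := Ftot _ _ FG FH.
      by exists H => //; split=> //; exact: GH.
    by exists G => //; split=> //; exact: HG.
  split=> [p [G FG Gp]|p q Fp Fq|p q Fp Fq].
  - by have [+ _ _] := FQ _ FG; apply.
  - by have [G FG [Gp Gq]] := two _ _ Fp Fq; have [_ + _] := FQ _ FG; apply.
  - by have [G FG [Gp Gq]] := two _ _ Fp Fq; have [_ _ +] := FQ _ FG; apply.
have [|/existsNP[u /not_implyP[Au uG]]] :=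
    pselect (forall u, A u -> exists v, G (u, v)).
  move=> tot; have {}tot u Au := cid (tot u Au); left.
  pose g u := if pselect (A u) is left Au then sval (tot u Au) else v0.
  have gP u : A u -> G (u, g u).
    by move=> Au; rewrite /g; case: pselect => // Au'; case: (tot u Au').
  exists g; split=> [u Au|u u' Au Au' gE]; first by have [] := GAB _ (gP _ Au).
  exact: (Ginj _ _ (gP _ Au) (gP _ Au')).
have [|/existsNP[v /not_implyP[Bv vG]]] :=
    pselect (forall v, B v -> exists u, G (u, v)).
  move=> tot; have {}tot v Bv := cid (tot v Bv); right.
  pose g v := if pselect (B v) is left Bv then sval (tot v Bv) else u0.
  have gP v : B v -> G (g v, v).
    by move=> Bv; rewrite /g; case: pselect => // Bv'; case: (tot v Bv').
  exists g; split=> [v Bv|v v' Bv Bv' gE]; first by have [] := GAB _ (gP _ Bv).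
  exact: (Gfun _ _ (gP _ Bv) (gP _ Bv')).
exfalso; apply: (Gmax (G `|` [set (u, v)])).
  split; first by move=> x Gx; left.
  by move=> sub; apply: uG; exists v; apply: sub; right.
split=> [p [/GAB//|->//]|p q [Gp|->] [Gq|->] //=|p q [Gp|->] [Gq|->] //=].
- exact: Gfun.
- by move=> E; case: uG; exists p.2; rewrite -E -surjective_pairing.
- by move=> E; case: uG; exists q.2; rewrite E -surjective_pairing.
- exact: Ginj.
- by move=> E; case: vG; exists p.1; rewrite -E -surjective_pairing.
- by move=> E; case: vG; exists q.1; rewrite E -surjective_pairing.
Qed.

Definition over (U : eqType) (D : set U) (l : seq U) : Prop :=
  forall x, x \in l -> D x.

Lemma over_cons (U : eqType) (D : set U) x l :
  over D (x :: l) <-> D x /\ over D l.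
Proof.
split=> [H|[Dx H] y].
  by split=> [|y yl]; apply: H; rewrite !inE ?eqxx ?yl ?orbT.
by rewrite inE => /orP[/eqP->|/H].
Qed.

(** Each letter becomes a tag followed by a letter of [D]. Words over the union of [D] and a
    disjoint set that injects into [D] thus become words over [D], of twice the length. *)
Definition double_code (U : Type) (c1 c2 : U -> U) (l : seq U) : seq U :=
  flatten [seq [:: c1 x; c2 x] | x <- l].

Lemma over_double_code (U : eqType) (c1 c2 : U -> U) (S D : set U) (l : seq U) :
  (forall x, S x -> D (c1 x) /\ D (c2 x)) -> over S l ->
  over D (double_code c1 c2 l).
Proof.
move=> h; elim: l => [//|x l IH] /over_cons[Sx Sl]; rewrite /double_code /=.
have [D1 D2] := h x Sx.
by apply/over_cons; split=> //; apply/over_cons; split=> //; exact: IH.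
Qed.

Lemma double_code_inj (U : eqType) (c1 c2 : U -> U) (S : set U) (l l' : seq U) :
  (forall x y, S x -> S y -> c1 x = c1 y -> c2 x = c2 y -> x = y) ->
  over S l -> over S l' -> double_code c1 c2 l = double_code c1 c2 l' -> l = l'.
Proof.
move=> h; elim: l l' => [|x l IH] [|y l'] //= /over_cons[Sx Sl] /over_cons[Sy Sl'].
by rewrite /double_code /= => -[E1 E2 /(IH _ Sl Sl') ->]; rewrite (h x y).
Qed.

(* Zorn's lemma for the pairs of a set D and an injection of seq D into D. *)
Lemma seq_inj_choiceType (U : choiceType) (h : nat -> U) : injective h ->
  exists J : seq U -> U, injective J.
Proof.
move=> hinj.
pose good (p : set U * (seq U -> U)) := [/\ range h `<=` p.1,
  forall l, over p.1 l -> p.1 (p.2 l) &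
  forall l l', over p.1 l -> over p.1 l' -> p.2 l = p.2 l' -> l = l'].
(* Only the values on words over the smaller set are compared, so [R] is a preorder and not an
   order. *)
pose R (p q : {p | good p}) := `[< (sval p).1 `<=` (sval q).1 /\
  forall l, over (sval p).1 l -> (sval q).2 l = (sval p).2 l >].
(* On a countable set, words are turned into lists of naturals and coded by a natural. *)
have base : good (range h, fun l => h (CodeSeq.code [seq xget 0 [set n | h n = x] | x <- l])).
  have gK n : xget 0 [set m | h m = h n] = n by case: xgetP => [m _ /hinj|/(_ n)[]].
  split=> //=; first by move=> l _; exists (CodeSeq.code [seq xget 0 [set n | h n = x] | x <- l]).
  move=> l l' ol ol' /hinj /(can_inj CodeSeq.codeK); elim: l l' ol ol' => [|x l IH] [|y l'] //.
  move=> /over_cons[[n _ <-] ol] /over_cons[[m _ <-] ol'] [].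
  by rewrite !gK => -> /(IH _ ol ol') ->.
have Rtrans p q r : R p q -> R q r -> R p r.
  move=> /asboolP[pq Epq] /asboolP[qr Eqr]; apply/asboolP; split.
    exact: subset_trans qr.
  by move=> l ol; rewrite Eqr ?Epq // => x /ol /pq.
have [||S Stot|[[D f] gDf] fmax] := @ZL_preorder _ (exist _ _ base) R.
- by move=> p; apply/asboolP; split.
- exact: Rtrans.
- have [[p0 Sp0]|S0] := pselect (exists p, S p); last first.
    by exists (exist _ _ base) => p Sp; case: S0; exists p.
  pose D := \bigcup_(p in S) (sval p).1.
  have cover l : over D l -> exists2 p, S p & over (sval p).1 l.
    elim: l => [_|x l IH /over_cons[[p Sp px] /IH[q Sq ql]]]; first by exists p0.
    have [/asboolP[pq _]|/asboolP[qp _]] := Stot _ _ Sp Sq.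
      by exists q => //; apply/over_cons; split=> //; exact: pq.
    by exists p => //; apply/over_cons; split=> // y /ql /qp.
  pose F l := xget (h 0) [set y | exists p, [/\ S p, over (sval p).1 l & y = (sval p).2 l]].
  have FE p l : S p -> over (sval p).1 l -> F l = (sval p).2 l.
    move=> Sp pl; rewrite /F; case: xgetP => [y _ [q [Sq ql ->]]|]; last first.
      by move=> /(_ ((sval p).2 l))[]; exists p.
    have [/asboolP[_ E]|/asboolP[_ E]] := Stot _ _ Sp Sq; first exact: E.
    by rewrite E.
  have gF : good (D, F).
    split=> /= [x hx|l ol|l l' ol ol'].
    + by exists p0 => //; have [+ _ _] := svalP p0; apply.
    + have [p Sp pl] := cover _ ol; rewrite (FE p) //; exists p => //.
      by have [_ + _] := svalP p; apply.
    + have [p Sp pl] := cover _ ol; have [q Sq ql] := cover _ ol'.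
      rewrite (FE p) // (FE q) //.
      have [/asboolP[pq E]|/asboolP[qp E]] := Stot _ _ Sp Sq.
        by rewrite -E //; have [_ _] := svalP q; apply=> // x /pl /pq.
      by rewrite -(E l') //; have [_ _] := svalP p; apply=> // x /ql /qp.
  exists (exist _ _ gF) => p Sp; apply/asboolP; split=> /=.
    by move=> x px; exists p.
  by move=> l pl; rewrite (FE p).
have [/= hD fD finj] := gDf.
have h01 : h 0 <> h 1 by move/hinj.
have Dh n : D (h n) by apply: hD; exists n.
have [[g [gN ginj]]|[g [gD ginj]]] := inj_into_total (h 0) (h 0) D (~` D).
  (* f extends to D together with its disjoint copy g(D), against maximality *)
  pose gi x := xget (h 0) [set y | D y /\ g y = x].
  have giK y : D y -> gi (g y) = y.
    move=> Dy; rewrite /gi; case: xgetP => [z _ [Dz]|/(_ y)[]//].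
    exact: ginj.
  pose D' := D `|` [set g y | y in D].
  pose c1 x := if pselect (D x) then h 0 else h 1.
  pose c2 x := if pselect (D x) then x else gi x.
  have cD x : D' x -> D (c1 x) /\ D (c2 x).
    rewrite /c1 /c2; case: pselect => /= [Dx _|nDx [//|[y Dy <-]]].
      by split=> //; exact: Dh.
    by rewrite giK //; split=> //; exact: Dh.
  have cinj x y : D' x -> D' y -> c1 x = c1 y -> c2 x = c2 y -> x = y.
    rewrite /c1 /c2; case: pselect => Dx; case: pselect => Dy //=.
    - by move=> _ _ /esym/h01.
    - by move=> [//|[x' Dx' <-]] [//|[y' Dy' <-]] _; rewrite !giK // => ->.
  pose f' l := if pselect (over D l) then f l else g (f (double_code c1 c2 l)).
  have dD l : over D' l -> D (f (double_code c1 c2 l)).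
    by move=> ol; apply: fD; exact: over_double_code ol.
  have good' : good (D', f').
    split=> /= [x /hD|l ol|l l' ol ol']; first by left.
      rewrite /f'; case: pselect => /= [/fD|_]; [by left|right].
      by exists (f (double_code c1 c2 l)) => //; exact: dD.
    rewrite /f'; case: pselect => Dl; case: pselect => Dl' /=.
    - exact: finj.
    - by move=> E; case: (gN _ (dD _ ol')); rewrite -E; exact: fD.
    - by move=> E; case: (gN _ (dD _ ol)); rewrite E; exact: fD.
    - move=> /(ginj _ _ (dD _ ol) (dD _ ol')).
      move=> /finj-/(_ (over_double_code cD ol) (over_double_code cD ol')).
      exact: double_code_inj cinj ol ol'.
  have /fmax/asboolP[/= sub _] : R (exist _ (D, f) gDf) (exist _ _ good').
    apply/asboolP; split=> /=; first by move=> x; left.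
    by move=> l ol; rewrite /f'; case: pselect.
  by case: (gN _ (Dh 0)); apply: sub; right; exists (h 0).
(* Here the complement of [D] injects into [D], so tagging sends words over all of [U] to words over
   [D], where [f] is injective. *)
pose c1 x := if pselect (D x) then h 0 else h 1.
pose c2 x := if pselect (D x) then x else g x.
have cD x : [set: U] x -> D (c1 x) /\ D (c2 x).
  by rewrite /c1 /c2; case: pselect => /= [Dx|nDx] _; split=> //; exact: gD.
have cinj x y : [set: U] x -> [set: U] y -> c1 x = c1 y -> c2 x = c2 y -> x = y.
  rewrite /c1 /c2; case: pselect => Dx; case: pselect => Dy //= _ _.
  - by move=> /esym/h01.
  - by move=> _; exact: ginj.
exists (fun l => f (double_code c1 c2 l)) => l l'.
have o s : over [set: U] s by [].
move=> /finj-/(_ (over_double_code cD (o l)) (over_double_code cD (o l'))).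
exact: double_code_inj cinj (o l) (o l').
Qed.

Lemma seq_inj (U : Type) (h : nat -> U) : injective h ->
  exists J : seq U -> U, injective J.
Proof. by elim/Pchoice : U h => U; exact: seq_inj_choiceType. Qed.

(** * Elementary substructures *)

Lemma inside_cons (X : Type) (n : nat) (A : set X) a (e : 'I_n -> X) :
  A a -> inside A e -> inside A (env_cons a e).
Proof. by move=> Aa Ae i; rewrite /env_cons; case: unlift => //=. Qed.

Lemma env_catL (X : Type) (m n : nat) (a : 'I_m -> X) (b : 'I_n -> X) i :
  env_cat a b (lshift n i) = a i.
Proof. by rewrite /env_cat -[lshift n i]/(unsplit (inl i)) unsplitK. Qed.

Lemma env_catR (X : Type) (m n : nat) (a : 'I_m -> X) (b : 'I_n -> X) i :
  env_cat a b (rshift m i) = b i.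
Proof. by rewrite /env_cat -[rshift m i]/(unsplit (inr i)) unsplitK. Qed.

Lemma env_consK (X : Type) (n : nat) (e : 'I_n.+1 -> X) :
  env_cons (e ord0) (fun i => e (lift ord0 i)) = e.
Proof.
by apply/funext => i; rewrite /env_cons; case: unliftP => [j ->|->].
Qed.

Lemma env_cons_cat (X : Type) (m n : nat) x (a : 'I_m -> X) (b : 'I_n -> X) :
  env_cons x (env_cat a b) = env_cat (env_cons x a) b.
Proof.
apply/funext => i; rewrite /env_cons; case: unliftP => [j ->|->] /=.
  case: (splitP j) => k jk.
    have -> : j = lshift n k by apply: val_inj.
    have -> : lift ord0 (lshift n k) = lshift n (lift ord0 k) by apply: val_inj.
    by rewrite env_catL [RHS]env_catL liftK.
  have -> : j = rshift m k by apply: val_inj.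
  have -> : lift ord0 (rshift m k) = rshift m.+1 k by apply: val_inj.
  by rewrite env_catR [RHS]env_catR.
have -> : ord0 = lshift n (ord0 : 'I_m.+1) by apply: val_inj.
by rewrite [RHS]env_catL unlift_none.
Qed.

(** A single formula defines [R] in [M] and [S] in [N]. The closure lemmas below build such formulas
    semantically, which avoids substitution and renaming of variables in the syntax. *)
Definition codef (L : language) (X : Type) (M N : structure L X) (n : nat)
    (R S : ('I_n -> X) -> Prop) : Prop :=
  exists f : form L n,
    (forall e, inside (dom M) e -> (sat M f e <-> R e)) /\
    (forall e, inside (dom N) e -> (sat N f e <-> S e)).

Section Codef.

Variables (L : language) (X : Type) (M N : structure L X).

Lemma codefP n (R S : ('I_n -> X) -> Prop) e : elem_sub M N ->
  codef M N R S -> inside (dom M) e -> (R e <-> S e).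
Proof.
move=> [sMN MN] [f [fR fS]] Me.
have Ne : inside (dom N) e by move=> i; apply: sMN.
by rewrite -fR // -fS //; exact: MN.
Qed.

Lemma codef_ext n (R S R' S' : ('I_n -> X) -> Prop) :
  (forall e, inside (dom M) e -> (R e <-> R' e)) ->
  (forall e, inside (dom N) e -> (S e <-> S' e)) ->
  codef M N R S -> codef M N R' S'.
Proof.
move=> RR' SS' [f [fR fS]]; exists f; split=> e De.
  by rewrite fR // RR'.
by rewrite fS // SS'.
Qed.

Lemma codef_false n : @codef L X M N n (fun _ => False) (fun _ => False).
Proof. by exists fFalse. Qed.

Lemma codef_eq n (i j : 'I_n) : codef M N (fun e => e i = e j) (fun e => e i = e j).
Proof. by exists (fEq _ i j). Qed.

Lemma codef_rel n (R : relsym L) (v : 'I_(arity R) -> 'I_n) :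
  codef M N (fun e => interp M (e \o v)) (fun e => interp N (e \o v)).
Proof. by exists (fRel v). Qed.

Lemma codef_imp n (R S R' S' : ('I_n -> X) -> Prop) :
  codef M N R S -> codef M N R' S' ->
  codef M N (fun e => R e -> R' e) (fun e => S e -> S' e).
Proof.
move=> [f [fR fS]] [g [gR gS]]; exists (fImp f g); split=> e De /=.
  by rewrite fR // gR.
by rewrite fS // gS.
Qed.

Lemma codef_all n (R S : ('I_n.+1 -> X) -> Prop) :
  codef M N R S ->
  codef M N (fun e => forall a, dom M a -> R (env_cons a e))
            (fun e => forall a, dom N a -> S (env_cons a e)).
Proof.
move=> [f [fR fS]]; exists (fAll f); split=> e De /=.
  by split=> h a Da; apply/(fR _ (inside_cons Da De)); exact: h.
by split=> h a Da; apply/(fS _ (inside_cons Da De)); exact: h.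
Qed.

Lemma codef_not n (R S : ('I_n -> X) -> Prop) :
  codef M N R S -> codef M N (fun e => ~ R e) (fun e => ~ S e).
Proof. by move=> h; apply: codef_imp h (codef_false _). Qed.

Lemma codef_and n (R S R' S' : ('I_n -> X) -> Prop) :
  codef M N R S -> codef M N R' S' ->
  codef M N (fun e => R e /\ R' e) (fun e => S e /\ S' e).
Proof.
move=> h h'; apply: codef_ext (codef_not (codef_imp h (codef_not h'))) => e _.
  by split=> [/not_implyP[? /contrapT]|[r r'] /(_ r)].
by split=> [/not_implyP[? /contrapT]|[r r'] /(_ r)].
Qed.

Lemma codef_ex n (R S : ('I_n.+1 -> X) -> Prop) :
  codef M N R S ->
  codef M N (fun e => exists a, dom M a /\ R (env_cons a e))
            (fun e => exists a, dom N a /\ S (env_cons a e)).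
Proof.
move=> h; apply: codef_ext (codef_not (codef_all (codef_not h))) => e _.
  by split=> [/existsNP[a /not_implyP[? /contrapT]]|[a [Da Ra] /(_ a Da)//]]; exists a.
by split=> [/existsNP[a /not_implyP[? /contrapT]]|[a [Da Ra] /(_ a Da)//]]; exists a.
Qed.

Lemma codef_forall_in n (I : eqType) (s : seq I) (R S : I -> ('I_n -> X) -> Prop) :
  (forall i, i \in s -> codef M N (R i) (S i)) ->
  codef M N (fun e => forall i, i \in s -> R i e) (fun e => forall i, i \in s -> S i e).
Proof.
elim: s => [_|i s IH h].
  by apply: codef_ext (codef_not (codef_false n)) => e _; split=> [_ i|_ []].
have hs := IH (fun j js => h j (mem_behead (s := i :: s) js)).
apply: codef_ext (codef_and (h i (mem_head _ _)) hs) => e _.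
  by split=> [[Ri Rs] j|Rs]; [rewrite inE => /orP[/eqP->|/Rs]
    |split=> [|j js]; apply: Rs; rewrite inE ?eqxx ?js ?orbT].
by split=> [[Ri Rs] j|Rs]; [rewrite inE => /orP[/eqP->|/Rs]
  |split=> [|j js]; apply: Rs; rewrite inE ?eqxx ?js ?orbT].
Qed.

Lemma codef_forall n k (R S : 'I_k -> ('I_n -> X) -> Prop) :
  (forall i, codef M N (R i) (S i)) ->
  codef M N (fun e => forall i, R i e) (fun e => forall i, S i e).
Proof.
move=> h; apply: codef_ext (codef_forall_in (s := enum 'I_k) (fun i _ => h i)) => e _.
  by split=> H i; [apply: H; rewrite mem_enum|].
by split=> H i; [apply: H; rewrite mem_enum|].
Qed.

Lemma codef_exists_in n (I : eqType) (s : seq I) (R S : I -> ('I_n -> X) -> Prop) :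
  (forall i, i \in s -> codef M N (R i) (S i)) ->
  codef M N (fun e => exists2 i, i \in s & R i e) (fun e => exists2 i, i \in s & S i e).
Proof.
move=> h.
apply: codef_ext (codef_not (codef_forall_in (fun i si => codef_not (h i si)))) => e _.
  by split=> [/existsNP[i /not_implyP[? /contrapT]]|[i si Ri] /(_ i si)//]; exists i.
by split=> [/existsNP[i /not_implyP[? /contrapT]]|[i si Ri] /(_ i si)//]; exists i.
Qed.

Lemma codef_ex_tuple k n (R S : ('I_(k + n) -> X) -> Prop) :
  codef M N R S ->
  codef M N (fun e => exists a, inside (dom M) a /\ R (env_cat a e))
            (fun e => exists a, inside (dom N) a /\ S (env_cat a e)).
Proof.
elim: k R S => [|k IH] R S h.
  have E (a : 'I_0 -> X) (e : 'I_n -> X) : env_cat a e = e.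
    apply/funext => i; rewrite -[X in env_cat _ _ X](_ : rshift 0 i = i) ?env_catR //.
    exact: val_inj.
  apply: codef_ext h => e _.
    by split=> [Re|[a []]]; [exists (@env0 X); split=> [[]//|]|]; rewrite E.
  by split=> [Re|[a []]]; [exists (@env0 X); split=> [[]//|]|]; rewrite E.
apply: codef_ext (IH _ _ (codef_ex (n := k + n) h)) => e _.
  split=> [[a [Da [x [Dx Rx]]]]|[a [Da Ra]]].
    exists (env_cons x a); split; first exact: inside_cons.
    by rewrite -env_cons_cat.
  exists (fun i => a (lift ord0 i)); split=> [i|]; first exact: Da.
  by exists (a ord0); split; [exact: Da|rewrite env_cons_cat env_consK].
split=> [[a [Da [x [Dx Rx]]]]|[a [Da Ra]]].
  exists (env_cons x a); split; first exact: inside_cons.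
  by rewrite -env_cons_cat.
exists (fun i => a (lift ord0 i)); split=> [i|]; first exact: Da.
by exists (a ord0); split; [exact: Da|rewrite env_cons_cat env_consK].
Qed.

(* Quantifiers are relativized to the definable universe. *)
Lemma elem_sub_interpreted (L' : language) (M' N' : structure L' X) :
  elem_sub M N -> dom M' `<=` dom M -> dom N' `<=` dom N ->
  (forall n (i : 'I_n), codef M N (fun e => dom M' (e i)) (fun e => dom N' (e i))) ->
  (forall n (R : relsym L') (v : 'I_(arity R) -> 'I_n),
     codef M N (fun e => interp M' (e \o v)) (fun e => interp N' (e \o v))) ->
  elem_sub M' N'.
Proof.
move=> MN sM sN cdom crel.
have cform n (f : form L' n) : codef M N (sat M' f) (sat N' f).
  elim: f => {n} [n|n i j|n R v|n f IHf g IHg|n f IH] /=.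
  - exact: codef_false.
  - exact: codef_eq.
  - exact: crel.
  - exact: codef_imp.
  - apply: codef_ext (codef_all (codef_imp (cdom _ ord0) IH)) => e _ /=.
      split=> h a Da; last by move=> M'a; apply: h; rewrite /env_cons unlift_none in M'a.
      by apply: h; [exact: sM|rewrite /env_cons unlift_none].
    split=> h a Da; last by move=> N'a; apply: h; rewrite /env_cons unlift_none in N'a.
    by apply: h; [exact: sN|rewrite /env_cons unlift_none].
split=> [x M'x|n f e M'e]; last first.
  by apply: (codefP MN (cform _ f)) => i; exact/sM.
by apply/(codefP (e := fun=> x) MN (cdom _ (ord0 : 'I_1))) => // _; exact: sM.
Qed.

End Codef.

Lemma elem_sub_trans (L : language) (X : Type) (M N O : structure L X) :
  elem_sub M N -> elem_sub N O -> elem_sub M O.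
Proof.
move=> [sMN MN] [sNO NO]; split=> [|n f e Me]; first exact: subset_trans sNO.
by rewrite MN // NO // => i; apply: sMN.
Qed.

Lemma elem_sub_factor (L : language) (X : Type) (M N O : structure L X) :
  dom M `<=` dom N -> elem_sub M O -> elem_sub N O -> elem_sub M N.
Proof.
move=> sMN [_ MO] [_ NO]; split=> // n f e Me.
by rewrite MO // NO // => i; exact: sMN.
Qed.

(** * Transfer of definable properties between sets and between systems *)

Section Sets.

Variables (L : language) (X : Type) (C : structure L X) (P : relsym L).
Variables (T : set (form L 0)) (K : Type).
Hypotheses (Cdom : dom C = setT) (CT : models C T) (TM : Morleyized T).

(** The right-hand side is atomic, hence can be evaluated in any induced structure. Since
    [Morleyized] needs a free variable, the lemmas that use this one treat the empty tuple
    separately. *)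
Lemma Morley_rel n (f : form L n.+1) :
  exists (R : relsym L) (v : 'I_(arity R) -> 'I_n.+1),
    forall e, sat C f e <-> interp C (e \o v).
Proof.
have [R [h Rh]] := TM f; exists R, (cast_ord h) => e.
by apply: Rh => // i; rewrite Cdom.
Qed.

Lemma small_sub (A B : set X) : A `<=` B -> small K B -> small K A.
Proof.
move=> AB [BK KB]; have AlB := subset_card_le AB; split.
  exact: card_le_trans BK.
by move=> KA; apply: KB; exact: card_le_trans AlB.
Qed.

Lemma pred_setE x : Defs.pred_set P C x <-> interp C (fun _ : 'I_(arity P) => x).
Proof. by rewrite /Defs.pred_set Cdom /=; split=> [[]|]. Qed.

(** With the formula replaced by a relation symbol, the existence of a solution in [P] and in the
    set is a first-order property of the parameters in the induced structure. *)
Lemma complete_elem_sub (V U : set X) :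
  elem_sub (induced C V) (induced C U) -> complete_set C P U -> complete_set C P V.
Proof.
move=> VU cU [|k] m f b Vb [a [Pa fa]].
  by exists a; split=> // -[].
have Ub : inside U b by move=> i; case: VU => + _; apply; exact: Vb.
have [a' [PUa fa']] := cU _ _ _ _ Ub (ex_intro _ a (conj Pa fa)).
have [R [v fR]] := Morley_rel (n := k + m) f.
have cR : codef (induced C V) (induced C U)
    (fun e : 'I_(k.+1 + m) -> X =>
       (forall i : 'I_k.+1, interp C (fun _ : 'I_(arity P) => e (lshift m i))) /\
       interp C (e \o v))
    (fun e : 'I_(k.+1 + m) -> X =>
       (forall i : 'I_k.+1, interp C (fun _ : 'I_(arity P) => e (lshift m i))) /\
       interp C (e \o v)).
  apply: codef_and; last exact: (codef_rel (induced C V) (induced C U) v).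
  apply: codef_forall => i.
  exact: (codef_rel (induced C V) (induced C U) (fun _ : 'I_(arity P) => lshift m i)).
have [] := (codefP VU (codef_ex_tuple cR) Vb).2.
  exists a'; split=> [i|]; first by have [] := PUa i.
  split=> [i|]; last exact/fR.
  by rewrite env_catL; apply/pred_setE; have [] := PUa i.
move=> c [Vc [Pc Rc]]; exists c; split; last exact/fR.
move=> i; split; last exact: Vc.
by apply/pred_setE; have := Pc i; rewrite env_catL.
Qed.

Lemma stable_elem_sub (V U : set X) :
  elem_sub (induced C V) (induced C U) -> stable C P T K U -> stable C P T K V.
Proof.
move=> VU [cU sU]; split; first exact: complete_elem_sub cU.
move=> A' A's A'V; apply: sU => // f; rewrite (A'V f).
by have [_] := VU; apply=> -[].
Qed.

Implicit Types (I : set {fset nat}) (A B : {fset nat} -> set X).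

Lemma codef_part I A B n (i : 'I_n) s : I s ->
  codef (system_structure C I A) (system_structure C I B)
    (fun e => A s (e i)) (fun e => B s (e i)).
Proof.
move=> Is.
exact: (@codef_rel (system_language L I) X (system_structure C I A)
  (system_structure C I B) n (inr (exist _ s Is)) (fun=> i)).
Qed.

Lemma codef_base I A B n (R : relsym L) (v : 'I_(arity R) -> 'I_n) :
  codef (system_structure C I A) (system_structure C I B)
    (fun e => interp C (e \o v)) (fun e => interp C (e \o v)).
Proof.
exact: (@codef_rel (system_language L I) X (system_structure C I A)
  (system_structure C I B) n (inl R) v).
Qed.

Lemma system_part I A B s x : system_elem_sub C I A B -> I s ->
  (\bigcup_(t in I) A t) x -> (A s x <-> B s x).
Proof.
by move=> AB Is Ax; apply: (codefP (e := fun=> x) AB (codef_part _ _ (ord0 : 'I_1) Is)).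
Qed.

Lemma system_part_sub I A B s : system_elem_sub C I A B -> I s -> A s `<=` B s.
Proof. by move=> AB Is x Ax; apply/(system_part AB Is) => //; exists s. Qed.

(** As [D] is finite, membership in the union is a finite disjunction of part predicates. *)
Lemma codef_union I A B (D : set {fset nat}) n (i : 'I_n) :
  finite_set D -> D `<=` I ->
  codef (system_structure C I A) (system_structure C I B)
    (fun e => (\bigcup_(t in D) A t) (e i)) (fun e => (\bigcup_(t in D) B t) (e i)).
Proof.
move=> finD DI; have inD := in_fset_set finD.
have h t : t \in fset_set D -> codef (system_structure C I A) (system_structure C I B)
    (fun e => A t (e i)) (fun e => B t (e i)).
  by rewrite inD => /set_mem /DI It; exact: codef_part.
apply: codef_ext (codef_exists_in h) => e _.
  by split=> [[t]|[t Dt]]; [rewrite inD => /set_mem; exists t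
    |exists t; rewrite ?inD //; exact: mem_set].
by split=> [[t]|[t Dt]]; [rewrite inD => /set_mem; exists t
  |exists t; rewrite ?inD //; exact: mem_set].
Qed.

Lemma union_elem_sub I A B (D : set {fset nat}) :
  finite_set D -> D `<=` I -> system_elem_sub C I A B ->
  elem_sub (induced C (\bigcup_(t in D) A t)) (induced C (\bigcup_(t in D) B t)).
Proof.
move=> finD DI AB; apply: elem_sub_interpreted AB _ _ _ _.
- by move=> x [t Dt]; exists t => //; exact: DI.
- by move=> x [t Dt]; exists t => //; exact: DI.
- by move=> n i; exact: codef_union.
- by move=> n R v; exact: codef_base.
Qed.

Lemma part_elem_sub I A B s : I s -> system_elem_sub C I A B ->
  elem_sub (induced C (A s)) (induced C (B s)).
Proof.
move=> Is /(union_elem_sub (finite_set1 s)); rewrite !bigcup_set1; apply.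
by move=> _ ->.
Qed.

(** Serves for smaller index sets, for the parts above the top index and for relabelled indices
    alike: the new universe is a finite union of old parts, hence definable. *)
Lemma system_elem_sub_reindex I I' A B A' B' (g : {fset nat} -> {fset nat}) :
  finite_set I' -> (forall s, I' s -> I (g s)) ->
  (forall s, I' s -> A' s = A (g s)) -> (forall s, I' s -> B' s = B (g s)) ->
  system_elem_sub C I A B -> system_elem_sub C I' A' B'.
Proof.
move=> finI gI AE BE AB; apply: elem_sub_interpreted AB _ _ _ _.
- by move=> x [t It]; rewrite AE // => ?; exists (g t) => //; exact: gI.
- by move=> x [t It]; rewrite BE // => ?; exists (g t) => //; exact: gI.
- move=> n i; have gfin : finite_set (g @` I') by exact: finite_image.
  have gsub : g @` I' `<=` I by move=> _ [s Is <-]; exact: gI.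
  apply: codef_ext (codef_union A B i gfin gsub) => e _ /=.
    split=> [[_ [s Is <-]]|[s Is]]; first by rewrite -AE // => ?; exists s.
    by rewrite AE // => ?; exists (g s) => //; exists s.
  split=> [[_ [s Is <-]]|[s Is]]; first by rewrite -BE // => ?; exists s.
  by rewrite BE // => ?; exists (g s) => //; exists s.
- move=> n [R|[s Is]] v /=; first exact: codef_base.
  by rewrite AE // BE //; exact: (codef_part _ _ _ (gI _ Is)).
Qed.

(** Common core of the reflection clause for elementary subsystems and for pairs. The entries in [F]
    already lie in [A] and act as parameters; the others are found again in [A] by elementarity. *)
Lemma system_reflect I A B k (f : form L k) (w : 'I_k -> {fset nat})
    (F : pred 'I_k) (b : 'I_k -> X) :
  system_elem_sub C I A B -> (exists x, (\bigcup_(t in I) A t) x) ->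
  (forall i, I (w i)) -> (forall i, B (w i) (b i)) ->
  (forall i, F i -> (\bigcup_(t in I) A t) (b i)) -> sat C f b ->
  exists a, [/\ forall i, A (w i) (a i), forall i, F i -> a i = b i & sat C f a].
Proof.
case: k f w F b => [|k] f w F b AB [x0 Ax0] Iw Bb Fb fb.
  by exists b; split=> // -[].
have [R [v fR]] := Morley_rel f.
(* Parameters must lie in the universe of [A]; [x0] fills the places of the entries outside [F],
   which [Q] does not inspect. *)
pose e i := if F i then b i else x0.
have Ae : inside (\bigcup_(t in I) A t) e.
  by move=> i; rewrite /e; case: ifP => // /Fb.
pose Q (D : {fset nat} -> set X) (c : 'I_(k.+1 + k.+1) -> X) :=
  ((forall i, D (w i) (c (lshift _ i))) /\
   (forall i, i \in enum F -> c (lshift _ i) = c (rshift _ i))) /\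
  interp C (c \o (lshift k.+1 \o v)).
have cQ : codef (system_structure C I A) (system_structure C I B) (Q A) (Q B).
  apply: codef_and; last exact: codef_base.
  apply: codef_and; first by apply: codef_forall => i; exact: codef_part.
  by apply: codef_forall_in => i _; exact: codef_eq.
have catv a c : @env_cat X k.+1 k.+1 a c \o (lshift k.+1 \o v) = a \o v.
  by apply/funext => i /=; rewrite env_catL.
have [] := (codefP AB (codef_ex_tuple cQ) Ae).2.
  exists b; split=> [i|]; first by exists (w i).
  split; last by rewrite catv; exact/fR.
  split=> i; first by rewrite env_catL.
  by rewrite mem_enum env_catL env_catR /e unfold_in => ->.
move=> a [_ [[Aa Fa] Ra]]; exists a; split.
- by move=> i; have := Aa i; rewrite env_catL.
- move=> i Fi; have := Fa i; rewrite mem_enum env_catL env_catR /e unfold_in Fi.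
  exact.
- by apply/fR; rewrite -(catv a e).
Qed.

End Sets.

(** * Index sets *)

Lemma in_nset k n : (k \in nset n) = (k < n).
Proof. by rewrite !inE /= mem_iota. Qed.

Lemma in_nset1 k n : (k \in nset1 n) = (0 < k < n).
Proof. by rewrite !inE /= mem_iota; case: n => [|n]; case: k. Qed.

Lemma nsetS n : nset n.+1 = (n |` nset n)%fset.
Proof. by apply/fsetP => i; rewrite in_fset1U !in_nset ltnS leq_eqVlt. Qed.

Lemma card_nset n : #|` nset n| = n.
Proof.
elim: n => [|n IH]; last by rewrite nsetS cardfsU1 in_nset ltnn IH.
by apply/eqP; rewrite cardfs_eq0; apply/eqP/fsetP => i; rewrite in_nset.
Qed.

Lemma finite_sub_power n (I : set {fset nat}) : I `<=` power (nset n) -> finite_set I.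
Proof.
move=> h; apply: sub_finite_set (finite_fset (fpowerset (nset n))) => s /h.
by rewrite /= fpowersetE.
Qed.

Lemma power_minusP (s t : {fset nat}) :
  power_minus s t <-> {subset t <= s} /\ exists2 x, x \in s & x \notin t.
Proof.
rewrite /power_minus /= fproperE; split=> [/andP[/fsubsetP ts /fsubsetPn] //|[ts st]].
by apply/andP; split; [exact/fsubsetP|exact/fsubsetPn].
Qed.

Lemma nice_gt0 n I : nice n I -> 0 < n. Proof. by case=> -[]. Qed.

Lemma nice_finite n I : nice n I -> finite_set I.
Proof. by case=> -[_ + _ _] _; exact: finite_sub_power. Qed.

Lemma nice_subset n I s t : nice n I -> I s -> (t `<=` s)%fset -> I t.
Proof. by case=> -[_ _ _ +] _; apply. Qed.

Lemma nice_lt n I s i : nice n I -> I s -> i \in s -> i < n.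
Proof. by case=> -[_ + _ _] _ => /[apply] /fsubsetP/[apply]; rewrite in_nset. Qed.

(** The element 0 is the most significant in the lexicographic order, so the sets omitting it form
    an initial segment. *)
Lemma nice_power1 n : 0 < n -> nice n (power (nset1 n)).
Proof.
move=> n0; split; first split=> //.
- move=> s /fsubsetP h; apply/fsubsetP => i /h.
  by rewrite in_nset in_nset1 => /andP[].
- by move=> s t ss ts; exact: fsubset_trans ss.
move=> s t /fsubsetP sn /fsubsetP tn [k [ks kt kmin]]; apply/fsubsetP => i it.
rewrite in_nset1; have := tn _ it; rewrite in_nset => ->.
rewrite andbT lt0n; apply/eqP => i0.
have := sn _ ks; rewrite in_nset1 => /andP[k0 _].
by have := kmin 0 k0; rewrite -i0 it => /esym/sn; rewrite in_nset1 i0.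
Qed.

Lemma nice_power n : 0 < n -> nice n (power (nset n)).
Proof.
move=> n0; split=> //; split=> //.
  move=> s /fsubsetP h; apply/fsubsetP => i /h.
  by rewrite in_nset in_nset1 => /andP[].
by move=> s t ss ts; exact: fsubset_trans ss.
Qed.

(** The full set is the greatest one, so removing it leaves an initial segment. *)
Lemma nice_power_minus n : 0 < n -> nice n (power_minus (nset n)).
Proof.
move=> n0; split; first split=> //.
- by move=> s /fproper_sub.
- move=> s /fsubsetP h; apply/power_minusP; split=> [i /h|].
    by rewrite in_nset in_nset1 => /andP[].
  exists 0; rewrite ?in_nset //; apply/negP => /h; by rewrite in_nset1.
- by move=> s t ss ts; exact: fsub_proper_trans ss.
move=> s t /fproper_sub/fsubsetP sn tn [k [ks kt _]].
rewrite /power_minus /= fproperEneq tn andbT; apply/eqP => E.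
by move: kt; rewrite E sn.
Qed.

Lemma nice_index_without m I : 0 < m -> nice m.+1 I -> nice m (index_without m I).
Proof.
move=> m0 [[_ In nI Isub] Ilex]; split; first split=> //.
- move=> s [/In/fsubsetP h ms]; apply/fsubsetP => i si.
  have := h _ si; rewrite !in_nset ltnS leq_eqVlt => /orP[/eqP im|//].
  by rewrite -im si in ms.
- move=> s /fsubsetP h; split; last first.
    by apply/negP => /h; rewrite in_nset1 ltnn andbF.
  apply: nI; apply/fsubsetP => i /h; rewrite !in_nset1 => /andP[-> im].
  by rewrite ltnS ltnW.
- move=> s t [Is ms] ts; split; first exact: Isub ts.
  by apply: contra ms; exact: (fsubsetP ts).
move=> s t [Is ms] /fsubsetP tm ts; split; last first.
  by apply/negP => /tm; rewrite in_nset ltnn.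
apply: Ilex Is _ ts; apply/fsubsetP => i /tm; rewrite !in_nset.
by move=> im; rewrite ltnS ltnW.
Qed.

Lemma nice_index_with m I : 0 < m -> nice m.+1 I -> nice m (index_with m I).
Proof.
move=> m0 [[_ In nI Isub] Ilex]; split; first split=> //.
- move=> s [ms /In/fsubsetP h]; apply/fsubsetP => i si.
  have := h i; rewrite in_fset1U si orbT => /(_ isT).
  rewrite !in_nset ltnS leq_eqVlt => /orP[/eqP im|//].
  by rewrite -im si in ms.
- move=> s /fsubsetP h; split; first by apply/negP => /h; rewrite in_nset1 ltnn andbF.
  apply: nI; apply/fsubsetP => i; rewrite in_fset1U => /orP[/eqP->|/h].
    by rewrite in_nset1 m0 ltnS leqnn.
  by rewrite !in_nset1 => /andP[-> im]; rewrite ltnS ltnW.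
- move=> s t [ms Is] ts; split; first by apply: contra ms; exact: (fsubsetP ts).
  by apply: Isub Is _; exact: fsetUS.
move=> s t [ms Is] /fsubsetP tm [k [ks kt kmin]].
have mt : m \notin t by apply/negP => /tm; rewrite in_nset ltnn.
split=> //; apply: Ilex Is _ _.
  apply/fsubsetP => i; rewrite in_fset1U => /orP[/eqP->|/tm]; rewrite !in_nset //.
  by move=> im; rewrite ltnS ltnW.
exists k; rewrite !in_fset1U ks orbT (negbTE kt) orbF; split=> //.
  by apply: contraNneq ms => <-.
by move=> j jk; rewrite !in_fset1U kmin.
Qed.

Lemma index_doubleP n I s : nice n I -> index_double n I s ->
  I (s `\ n)%fset /\ (n \notin s -> I s).
Proof.
move=> nI; have nin t : I t -> n \notin t.
  by move=> It; apply/negP => /(nice_lt nI It); rewrite ltnn.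
case=> [Is|[t It <-]]; last first.
  split; last by rewrite in_fset1U eqxx.
  suff -> : ((n |` t) `\ n = t)%fset by [].
  apply/fsetP => i; rewrite !inE; case: eqP => [->|] //=.
  by rewrite (negbTE (nin _ It)).
by split=> //; apply: nice_subset nI Is _; exact: fsubD1set.
Qed.

Lemma nice_double n I : nice n I -> nice n.+1 (index_double n I).
Proof.
move=> nI; have [[n0 In pI Isub] Ilex] := nI.
(* The doubled index set consists of the subsets of [nset n.+1] that fall into [I] once [n] is
   removed. *)
have memJ s : (s `<=` nset n.+1)%fset -> I (s `\ n)%fset -> index_double n I s.
  move=> sn Is; have [ns|ns] := boolP (n \in s); last first.
    by left; move: Is; rewrite mem_fsetD1.
  by right; exists (s `\ n)%fset => //; rewrite fsetD1K.
have Jn s : index_double n I s -> (s `<=` nset n.+1)%fset.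
  rewrite nsetS; case=> [/In h|[t /In h <-]]; last exact: fsetUS.
  by apply: fsubset_trans h _; exact: fsubsetUr.
split; first split=> //.
- move=> s /fsubsetP h; apply: memJ.
    by apply/fsubsetP => i /h; rewrite in_nset1 in_nset => /andP[].
  apply: pI; apply/fsubsetP => i; rewrite in_fsetD1 => /andP[inn /h].
  by rewrite !in_nset1 ltnS => /andP[-> ]; rewrite leq_eqVlt (negbTE inn).
- move=> s t Js ts; apply: memJ; first exact: fsubset_trans ts (Jn _ Js).
  apply: Isub (index_doubleP nI Js).1 _; exact: fsetSD.
move=> s t Js tn [k [ks kt kmin]]; apply: memJ => //.
have [Is _] := index_doubleP nI Js.
(* The new index [n] is the least significant one: sets that first differ there agree after its
   removal, and any other comparison is already decided in [I]. *)
have [kn|kn] := eqVneq k n.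
  suff -> : (t `\ n = s `\ n)%fset by [].
  apply/fsetP => i; rewrite !in_fsetD1; case: (ltngtP i n) => //= [ilt|igt].
    by rewrite kmin ?kn.
  have ni u : (u `<=` nset n.+1)%fset -> i \in u = false.
    move=> /fsubsetP un; apply/negP => /un; rewrite in_nset ltnS leqNgt.
    by rewrite igt.
  by rewrite !ni //; exact: Jn.
apply: Ilex Is _ _.
  apply/fsubsetP => i; rewrite in_fsetD1 => /andP[inn /(fsubsetP tn)].
  by rewrite !in_nset ltnS leq_eqVlt (negbTE inn).
have kltn : k < n.
  by have /fsubsetP/(_ _ ks) := Jn _ Js; rewrite in_nset ltnS leq_eqVlt (negbTE kn).
exists k; rewrite !in_fsetD1 kn ks (negbTE kt) andbF; split=> // j jk.
by rewrite !in_fsetD1 kmin.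
Qed.

Lemma imfsetD1 (f : nat -> nat) s m : injective f ->
  (f @` (s `\ m) = (f @` s) `\ f m)%fset.
Proof.
move=> fi; apply/fsetP => i; rewrite in_fsetD1; apply/imfsetP/andP.
  move=> [j /= + ->]; rewrite in_fsetD1 => /andP[jm js].
  by rewrite (inj_eq fi) jm in_imfset.
move=> [im /imfsetP[j /= js ij]]; exists j => //=.
by rewrite in_fsetD1 js andbT; apply: contra im => /eqP <-; rewrite ij.
Qed.

Lemma bigcup_power_minus_image (X : Type) (f : nat -> nat) (s : {fset nat})
    (F : {fset nat} -> set X) : injective f ->
  \bigcup_(t in power_minus (f @` s)%fset) F t =
  \bigcup_(t in power_minus s) F (f @` t)%fset.
Proof.
move=> fi; have memf i t : (f i \in (f @` t)%fset) = (i \in t) by rewrite mem_imfset.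
apply/seteqP; split=> x [t /power_minusP[tsub [y ys yt]] Fx]; last first.
  exists (f @` t)%fset => //; apply/power_minusP; split.
    by move=> _ /imfsetP[i /= /tsub si ->]; rewrite memf.
  by exists (f y); rewrite memf.
have E : (f @` [fset i in s | f i \in t] = t)%fset.
  apply/fsetP => i; apply/imfsetP/idP => [[j /=]|it].
    by rewrite !inE /= => /andP[_ jt] ->.
  have /imfsetP[j /= js ij] := tsub _ it.
  by exists j => //=; rewrite !inE /= js -ij.
exists [fset i in s | f i \in t]%fset; last by rewrite E.
have /imfsetP[j /= js yj] := ys.
apply/power_minusP; split=> [i|]; first by rewrite !inE => /andP[].
by exists j => //; rewrite !inE /= -yj (negbTE yt) andbF.
Qed.

Section Increasing.

Variable f : nat -> nat.
Hypothesis f_lt : {homo f : i j / i < j}.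

Lemma increasing_inj : injective f.
Proof.
by move=> i j E; case: (ltngtP i j) => // /f_lt; rewrite E ltnn.
Qed.

Lemma increasing_ge i : i <= f i.
Proof. by elim: i => // i IH; apply: leq_ltn_trans IH _; exact: f_lt. Qed.

End Increasing.

(** The enumeration of [s] is prolonged by [n], then [n + 1], and so on. Hence it is increasing on
    all of [nat], and it carries the top index of a doubled system over [#|s|] to the top index
    [n]. *)
Lemma increasing_enum (s : {fset nat}) n : 0 \in s -> (s `<=` nset n)%fset ->
  exists f : nat -> nat, [/\ {homo f : i j / i < j}, f 0 = 0,
    f #|` s| = n & (f @` nset #|` s| = s)%fset].
Proof.
move=> s0 /fsubsetP sn; pose e := [seq i <- iota 0 n | i \in s].
have eu : uniq e by rewrite filter_uniq // iota_uniq.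
have mem_e : e =i s.
  move=> i; rewrite mem_filter mem_iota /= add0n.
  by case: (boolP (i \in s)) => // /sn; rewrite in_nset.
have es : size e = #|` s|.
  rewrite cardfE /= -(card_seq_sub eu) -!sum1_card; apply/eqP.
  by rewrite !sum1_card card_seq_sub // -cardfE; apply/eqP/perm_size/uniq_perm.
have n0 : 0 < n by rewrite -in_nset sn.
have e0 : 0 < size e by rewrite -has_predT; apply/hasP; exists 0; rewrite ?mem_e.
pose f i := if i < size e then nth 0 e i else n + (i - size e).
have esort : sorted ltn e by apply: sorted_filter (iota_ltn_sorted _ _); exact: ltn_trans.
have en i : i < size e -> nth 0 e i < n.
  by move=> ie; rewrite -in_nset; apply: sn; rewrite -mem_e mem_nth.
exists f; rewrite -es; split.
- move=> i j ij; rewrite /f; case: (ltnP j (size e)) => je.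
    rewrite (ltn_trans ij je); apply: (sorted_ltn_nth ltn_trans 0 esort) => //.
    by rewrite inE (ltn_trans ij je).
  case: (ltnP i (size e)) => ie; first exact: leq_trans (en _ ie) (leq_addr _ _).
  by rewrite ltn_add2l ltn_sub2r // (leq_ltn_trans ie ij).
- by rewrite /f e0 /e; case: (n) n0 => //= k _; rewrite s0.
- by rewrite /f ltnn subnn addn0.
- apply/fsetP => i; rewrite -mem_e; apply/imfsetP/idP => [[j /=]|ie].
    by rewrite in_nset /f => je ->; rewrite je mem_nth.
  exists (index i e); rewrite /= ?in_nset ?index_mem //.
  by rewrite /f index_mem ie nth_index.
Qed.

(** * Good systems *)

Section Good.

Variables (L : language) (X : Type) (C : structure L X) (P : relsym L).
Variables (T : set (form L 0)) (K : Type).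
Hypotheses (Cdom : dom C = setT) (CT : models C T) (TM : Morleyized T).
Hypothesis P_nonempty : exists x, Defs.pred_set P C x.

Implicit Types (I J : set {fset nat}) (A B : {fset nat} -> set X).

Local Notation good := (good_system C P T K).
Local Notation base := (good_base C P T K).

Lemma good_goodbase n I A : good n I A -> base n I A.
Proof. by case: n => // n []. Qed.

(** The part at the empty index is elementary in the structure on [P], which satisfies a sentence
    saying that some element exists. *)
Lemma goodbase_nonempty n I A : base n I A -> exists x, (\bigcup_(t in I) A t) x.
Proof.
case=> [[[n0 _ nI _] _]] _ _ Amod _.
have I0 : I fset0 by apply: nI; exact: fsub0set.
have [/(_ isT)[_ A0] _] := Amod _ I0.
have [x Px] := P_nonempty.
have h : sat (induced C (A fset0)) (fNot (fAll fFalse)) (@env0 X).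
  by apply/A0; [case|move/(_ x Px)].
apply: contrapT => Ane; apply: h => y Ay; apply: Ane; exists y.
by exists fset0.
Qed.

Lemma goodbase_restrict n k I J A B (f : nat -> nat) :
  injective f -> f 0 = 0 -> base n I A -> nice k J ->
  (forall s, J s -> I (f @` s)%fset) -> (forall s, J s -> B s = A (f @` s)%fset) ->
  base k J B.
Proof.
move=> fi f0 [nI Asmall Acap Amod [AP Astab]] nJ fJ BA.
have mem0 s : (0 \in (f @` s)%fset) = (0 \in s) by rewrite -{1}f0 mem_imfset.
split=> //.
- by move=> s Js; rewrite BA //; apply: Asmall; exact: fJ.
- move=> s t Js Jt; rewrite !BA ?Acap ?imfsetI //; try exact: fJ.
    by move=> x y _ _; exact: fi.
  by apply: nice_subset nJ Js _; exact: fsubsetIl.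
- by move=> s Js; have := Amod _ (fJ _ Js); rewrite mem0 BA.
split=> s Js.
  rewrite !BA ?AP ?imfsetD1 ?f0 //; first exact: fJ.
  by apply: nice_subset nJ Js _; exact: fsubD1set.
move=> s0; have := Astab _ (fJ _ Js); rewrite mem0 => /(_ s0).
rewrite bigcup_power_minus_image //; congr stable.
apply: eq_bigcupr => t ts; rewrite BA //.
by apply: nice_subset nJ Js _; exact: fproper_sub.
Qed.

(** The map must fix 0, which the clauses on models, on [P] and on stability single out, and must
    preserve order, because the other clauses peel off the largest index. *)
Lemma good_restrict n k I J A B (f : nat -> nat) :
  {homo f : i j / i < j} -> f 0 = 0 -> good n I A -> nice k J ->
  (forall s, J s -> I (f @` s)%fset) -> (forall s, J s -> B s = A (f @` s)%fset) ->
  good k J B.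
Proof.
move=> flt f0; have fi := increasing_inj flt.
elim: n k I J A B => [//|m IH] k I J A B gA nJ fJ BA.
have bB : base k J B := goodbase_restrict fi f0 (good_goodbase gA) nJ fJ BA.
case: k nJ bB => [/nice_gt0//|k] nJ bB.
have [k0|k0] := posnP k; first by split=> //; rewrite k0.
have [[nI _ _ _ _]] := gA.
have Jk1 s : (s `<=` nset1 k.+1)%fset -> J s by case: nJ => -[_ _ + _] _; apply.
have Jk : J [fset k]%fset.
  by apply: Jk1; rewrite fsub1set in_nset1 k0 ltnS leqnn.
have fkm : f k < m.+1.
  by apply: (nice_lt nI (fJ _ Jk)); rewrite in_imfset //= in_fset1.
have m0 : 0 < m.
  by rewrite -ltnS; apply: leq_trans fkm; apply: leq_trans k0 _; exact: increasing_ge.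
move=> /(_ m0)[[AA gA1 gAa] refl gAw gAwo].
(* If the largest index [k] does not go to [m], no image of a set in [J] contains [m] and the old
   system without [m] suffices. Otherwise the top indices correspond and every clause restricts. *)
have [fk|fkNm] := eqVneq (f k) m; last first.
  apply: IH gAwo (nJ) _ BA => s Js; split; first exact: fJ.
  apply/negP => /imfsetP[i /= si mi].
  have := nice_lt nJ Js si; rewrite ltnS leq_eqVlt => /orP[/eqP ik|ik].
    by rewrite mi ik eqxx in fkNm.
  by have := flt _ _ ik; rewrite -mi; rewrite ltnNge -ltnS fkm.
have fnset1 s : power (nset1 k) s -> power (nset1 m) (f @` s)%fset.
  move=> /fsubsetP sk; apply/fsubsetP => _ /imfsetP[i /= /sk + ->].
  rewrite !in_nset1 => /andP[i0 ik].
  by rewrite -{1}f0 flt //= -fk flt.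
have n1k : nice k (power (nset1 k)) by exact: nice_power1.
have kJ s : power (nset1 k) s -> J s.
  move=> /fsubsetP sk; apply: Jk1; apply/fsubsetP => i /sk.
  by rewrite !in_nset1 => /andP[-> ik]; rewrite ltnS ltnW.
have kJ' s : power (nset1 k) s -> J (k |` s)%fset.
  move=> /fsubsetP sk; apply: Jk1; apply/fsubsetP => i.
  rewrite in_fset1U => /orP[/eqP->|/sk]; first by rewrite in_nset1 k0 ltnS leqnn.
  by rewrite !in_nset1 => /andP[-> ik]; rewrite ltnS ltnW.
split=> // _ above.
have E s : J (k |` s)%fset -> above s = A (m |` (f @` s))%fset.
  by move=> Js; rewrite /above BA // imfsetU1 fk.
split.
- split.
  + apply: system_elem_sub_reindex (nice_finite n1k) (fnset1) _ _ AA => s ks.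
      by apply: BA; exact: kJ.
    by apply: E; exact: kJ'.
  + by apply: IH gA1 n1k fnset1 _ => s ks; apply: BA; exact: kJ.
  + by apply: IH gAa n1k fnset1 _ => s ks; apply: E; exact: kJ'.
- move=> l phi u b ub phib.
  have [|b' [b'A b'b phib']] := refl l phi (fun i => f @` (u i))%fset b _ phib.
    by move=> i; have [Ju Bb] := ub i; split; [exact: fJ|rewrite -BA].
  exists b'; split=> // i; have [Ju _] := ub i.
    rewrite BA; first by rewrite imfsetD1 // fk.
    by apply: nice_subset nJ Ju _; exact: fsubD1set.
  by move=> ku; apply: b'b; rewrite -fk mem_imfset.
- apply: IH gAw (nice_index_with k0 nJ) _ _ => s [ks Js]; last exact: E.
  split; first by rewrite -fk mem_imfset.
  by rewrite -fk -imfsetU1; exact: fJ.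
- apply: IH gAwo (nice_index_without k0 nJ) _ _ => s [Js ks]; last exact: BA.
  by split; [exact: fJ|rewrite -fk mem_imfset].
Qed.

Lemma good_sub n I J A B : good n I A -> nice n J -> J `<=` I ->
  (forall s, J s -> B s = A s) -> good n J B.
Proof.
move=> gA nJ JI BA; apply: (good_restrict (f := id)) gA nJ _ _ => // s Js.
  by rewrite imfset_id; exact: JI.
by rewrite imfset_id; exact: BA.
Qed.

Lemma finite_power_minus s : finite_set (power_minus s).
Proof.
apply: sub_finite_set (finite_fset (fpowerset s)) => t /fproper_sub.
by rewrite /= fpowersetE.
Qed.

Lemma system_partE I A B s : system_elem_sub C I B A -> I s ->
  B s = A s `&` \bigcup_(t in I) B t.
Proof.
move=> BA Is; apply/seteqP; split=> [x Bx|x [Ax Bx]].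
  by split; [exact: (system_part_sub BA Is)|exists s].
exact/(system_part BA Is).
Qed.

Lemma goodbase_elem_sub n I A B : system_elem_sub C I B A -> base n I A -> base n I B.
Proof.
move=> BA bA; have [nI Asmall Acap Amod [AP Astab]] := bA.
have BE s := system_partE (s := s) BA.
split=> //.
- by move=> s Is; apply: small_sub (system_part_sub BA Is) (Asmall _ Is).
- move=> s t Is It; have Ist : I (s `&` t)%fset.
    by apply: nice_subset nI Is _; exact: fsubsetIl.
  by rewrite !BE // -Acap // setIACA setIid.
- move=> s Is; have [h0 h1] := Amod _ Is; have BsAs := part_elem_sub Is BA.
  by split=> [/h0|/h1]; exact: elem_sub_trans.
split=> s Is.
  have Is0 : I (s `\ 0)%fset by apply: nice_subset nI Is _; exact: fsubD1set.
  by rewrite !BE // -AP // setIAC.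
move=> s0; apply: stable_elem_sub (Astab _ Is s0) => //.
apply: union_elem_sub BA; first exact: finite_power_minus.
by move=> t ts; apply: nice_subset nI Is _; exact: fproper_sub.
Qed.

Lemma good_elem_sub n I A B : system_elem_sub C I B A -> good n I A -> good n I B.
Proof.
elim: n I A B => [//|m IH] I A B BA gA.
have bB := goodbase_elem_sub BA (good_goodbase gA).
split=> // m0 above.
have [bA /(_ m0)[[AA gA1 gAa] refl gAw gAwo]] := gA.
have nI : nice m.+1 I by case: bA.
have n1m : nice m (power (nset1 m)) by exact: nice_power1.
have nI1 s : (s `<=` nset1 m.+1)%fset -> I s by case: nI => -[_ _ + _] _; apply.
have mI s : power (nset1 m) s -> I s.
  move=> /fsubsetP sk; apply: nI1; apply/fsubsetP => i /sk.
  by rewrite !in_nset1 => /andP[-> ik]; rewrite ltnS ltnW.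
have mI' s : power (nset1 m) s -> I (m |` s)%fset.
  move=> /fsubsetP sk; apply: nI1; apply/fsubsetP => i.
  rewrite in_fset1U => /orP[/eqP->|/sk]; first by rewrite in_nset1 m0 ltnS leqnn.
  by rewrite !in_nset1 => /andP[-> ik]; rewrite ltnS ltnW.
have sub1 J : nice m J -> J `<=` I -> system_elem_sub C J B A.
  by move=> nJ JI; apply: system_elem_sub_reindex (nice_finite nJ) JI _ _ BA.
have sub2 J : nice m J -> (forall s, J s -> I (m |` s)%fset) ->
    system_elem_sub C J above (fun s => A (m |` s)%fset).
  by move=> nJ JI; apply: system_elem_sub_reindex (nice_finite nJ) JI _ _ BA.
split.
- split; last 2 first.
  + by apply: IH gA1; exact: sub1.
  + by apply: IH gAa; exact: sub2.
  (* Both the lower and the upper half of [B] are elementary in the upper half of [A]; the inclusion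
     between their universes comes from the intersection clause for [B]. *)
  apply: elem_sub_factor (elem_sub_trans (sub1 _ n1m mI) AA) (sub2 _ n1m mI').
  move=> x [s ms Bx]; exists s => //; rewrite /above.
  have [_ _ Bcap _ _] := bB.
  have : (B s `&` B (m |` s)%fset) x.
    rewrite Bcap; [|exact: mI|exact: mI'].
    by have /fsetIidPl -> : (s `<=` m |` s)%fset by exact: fsubsetUr.
  by case.
- move=> l phi u b ub phib.
  (* The tuple is reflected down inside [A], then moved from [A] to [B]; both moves fix the entries
     whose index omits [m]. *)
  have [|b' [b'A b'b phib']] := refl l phi u b _ phib.
    by move=> i; have [Iu Bb] := ub i; split=> //; exact: (system_part_sub BA Iu).
  have Iw i : I (u i `\ m)%fset.
    by have [Iu _] := ub i; apply: nice_subset nI Iu _; exact: fsubD1set.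
  have [|i|a [Ba ab phia]] := system_reflect Cdom CT TM (F := fun i => m \notin u i)
      BA _ Iw b'A _ phib'.
  + exact: goodbase_nonempty bB.
  + by move=> mu; rewrite b'b //; have [Iu Bb] := ub i; exists (u i).
  by exists a; split=> // i mu; rewrite ab // b'b.
- apply: IH gAw; apply: sub2; first exact: nice_index_with.
  by move=> s [].
- apply: IH gAwo; apply: sub1; first exact: nice_index_without.
  by move=> s [].
Qed.

(** Stability at the indices containing [n] and 0 is kept as a hypothesis, since [pair_stable] is
    itself proved with this lemma. The index set [J] is free so as to cover the proper subsets of
    [nset n.+1] as well as the whole doubled index set. *)
Lemma good_pair n I J A B :
  good n I A -> good n I B -> system_elem_sub C I A B ->
  nice n.+1 J -> J `<=` index_double n I ->
  (forall s, J s -> n \in s -> 0 \in s ->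
     stable C P T K (\bigcup_(t in power_minus s) pair_system n A B t)) ->
  good n.+1 J (pair_system n A B).
Proof.
move=> gA gB AB nJ JI Jstab; have [bA bB] := (good_goodbase gA, good_goodbase gB).
have [nI Asmall Acap Amod [AP Astab]] := bA.
have [_ Bsmall Bcap Bmod [BP Bstab]] := bB.
have n0 := nice_gt0 nI.
have JD s : J s -> I (s `\ n)%fset by move=> /JI/(index_doubleP nI)[].
have JN s : J s -> n \notin s -> I s by move=> /JI/(index_doubleP nI)[].
have pN s : n \notin s -> pair_system n A B s = A s.
  by rewrite /pair_system => /negbTE ->.
have pY s : n \in s -> pair_system n A B s = B (s `\ n)%fset.
  by rewrite /pair_system => ->.
have sAB s : I s -> A s `<=` B s by move=> Is; exact: (system_part_sub AB Is).
have nIn s : I s -> n \notin s.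
  by move=> Is; apply/negP => /(nice_lt nI Is); rewrite ltnn.
(* A part of [A] is the part of [B] cut by the universe of [A], so mixed intersections reduce to
   those of [B]. *)
have capAB s t : I s -> I t -> B s `&` A t = A (s `&` t)%fset.
  move=> Is It; have Ist : I (s `&` t)%fset.
    by apply: nice_subset nI Is _; exact: fsubsetIl.
  rewrite (system_partE AB Ist) (system_partE AB It) -Bcap //.
  by rewrite setIA.
split; last first.
  move=> _ above.
  have n1n : nice n (power (nset1 n)) by exact: nice_power1.
  have I1 : power (nset1 n) `<=` I by case: nI => -[].
  have aB s : n \notin s -> above s = B s.
    by move=> ns; rewrite /above pY ?fset1U1 // fsetU1K.
  split.
  - split.
    + apply: system_elem_sub_reindex (nice_finite n1n) (I1) _ _ (AB) => s /I1/nIn.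
        exact: pN.
      exact: aB.
    + by apply: good_sub (gA) (n1n) (I1) _ => s /I1/nIn; exact: pN.
    + by apply: good_sub (gB) (n1n) (I1) _ => s /I1/nIn; exact: aB.
  - move=> l phi u b ub phib.
    have Iw i : I (u i `\ n)%fset by have [/JD] := ub i.
    have [||i|a [Aa ab phia]] := system_reflect Cdom CT TM (F := fun i => n \notin u i)
        AB _ Iw _ _ phib.
    + exact: goodbase_nonempty bA.
    + move=> i; have [Ju] := ub i; have [nu|nu] := boolP (n \in u i); first by rewrite pY.
      by rewrite pN // mem_fsetD1 //; apply: sAB; exact: JN.
    + move=> nu; have [Ju] := ub i; rewrite pN // => Aub.
      by exists (u i) => //; exact: JN.
    by exists a; split=> // i; rewrite pN; [exact: Aa|rewrite in_fsetD1 eqxx].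
  - apply: good_sub gB (nice_index_with n0 nJ) _ _ => s [ns Js]; last exact: aB.
    by have := JD _ Js; rewrite fsetU1K.
  - by apply: good_sub gA (nice_index_without n0 nJ) _ _ => s [Js ns]; [exact: JN|exact: pN].
have n00 : (0 == n) = false by rewrite eq_sym; apply/negbTE; rewrite -lt0n.
split=> //.
- move=> s Js; have [ns|ns] := boolP (n \in s).
    by rewrite pY //; apply: Bsmall; exact: JD.
  by rewrite pN //; apply: Asmall; exact: JN.
- move=> s t Js Jt; have [ns|ns] := boolP (n \in s); have [nt|nt] := boolP (n \in t).
  + rewrite !pY ?in_fsetI ?ns // Bcap; [|exact: JD|exact: JD].
    by congr B; apply/fsetP => i; rewrite !inE; case: (i == n).
  + rewrite (pY s) // !pN ?in_fsetI ?(negbTE nt) ?andbF //.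
    rewrite capAB; [|exact: JD|exact: JN].
    congr A; apply/fsetP => i; rewrite !inE; case: eqP => [->|//] /=.
    by rewrite (negbTE nt) andbF.
  + rewrite (pY t) // !pN ?in_fsetI ?(negbTE ns) //.
    rewrite setIC capAB; [|exact: JD|exact: JN].
    congr A; apply/fsetP => i; rewrite !inE; case: eqP => [->|_] /=.
      by rewrite (negbTE ns).
    by rewrite andbC.
  + by rewrite !pN ?in_fsetI ?(negbTE ns) // Acap //; apply: JN.
- move=> s Js; have [ns|ns] := boolP (n \in s).
    by have := Bmod _ (JD _ Js); rewrite in_fsetD1 n00 /= pY.
  by rewrite pN //; apply: Amod; exact: JN.
split=> s Js.
  have [ns|ns] := boolP (n \in s).
    rewrite !pY ?in_fsetD1 ?ns 1?eq_sym ?n00 // BP; last exact: JD.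
    by congr B; apply/fsetP => i; rewrite !inE andbCA.
  by rewrite !pN ?in_fsetD1 ?(negbTE ns) ?andbF // AP //; exact: JN.
have [ns|ns] := boolP (n \in s); first exact: Jstab.
move=> s0; have := Astab _ (JN _ Js ns) s0; congr stable.
apply: eq_bigcupr => t ts; rewrite pN //.
by apply: contra ns; apply/fsubsetP; exact: fproper_sub.
Qed.

Lemma pair_system_image n A B (f : nat -> nat) m s : injective f -> f m = n ->
  pair_system m (fun t => A (f @` t)%fset) (fun t => B (f @` t)%fset) s =
  pair_system n A B (f @` s)%fset.
Proof.
move=> fi <-; rewrite /pair_system mem_imfset //=.
by case: ifP => // _; rewrite imfsetD1.
Qed.

Hypothesis T_stable : forall n, n_stable C P T K n.

(* Enumerating s turns the pair over the proper subsets of n |` s into a system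
   indexed by the proper subsets of #|s| + 1, to which n-stability applies; its
   goodness only involves the same claim for smaller s. *)
Lemma pair_stable n I A B s :
  good n I A -> good n I B -> system_elem_sub C I A B -> I s -> 0 \in s ->
  stable C P T K (\bigcup_(t in power_minus (n |` s)%fset) pair_system n A B t).
Proof.
have [k] := ubnP #|` s|.
elim: k n I A B s => // k IH n I A B s sk gA gB AB Is s0.
have [nI _ _ _ _] := good_goodbase gA.
have sn : (s `<=` nset n)%fset by case: nI => -[_ + _ _] _; apply.
have [f [flt f0 fs fsE]] := increasing_enum s0 sn.
have fi := increasing_inj flt.
set j := #|` s| in sk fs fsE.
have j0 : 0 < j by rewrite cardfs_gt0; apply/fset0Pn; exists 0.
have nj := nice_power j0.
have fI t : power (nset j) t -> I (f @` t)%fset.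
  move=> /fsubsetP tj; apply: nice_subset nI Is _; rewrite -fsE.
  by apply/fsubsetP => _ /imfsetP[i /= /tj ij ->]; rewrite mem_imfset.
pose A1 (t : {fset nat}) := A (f @` t)%fset; pose B1 (t : {fset nat}) := B (f @` t)%fset.
have gA1 : good j (power (nset j)) A1 by exact: good_restrict flt f0 gA nj fI _.
have gB1 : good j (power (nset j)) B1 by exact: good_restrict flt f0 gB nj fI _.
have AB1 : system_elem_sub C (power (nset j)) A1 B1.
  exact: system_elem_sub_reindex (nice_finite nj) fI _ _ AB.
have -> : (n |` s = f @` nset j.+1)%fset by rewrite nsetS imfsetU1 fs fsE.
rewrite bigcup_power_minus_image //.
under eq_bigcupr do rewrite -(pair_system_image _ _ _ fi fs).
apply: T_stable; apply: good_pair (gA1) (gB1) (AB1) _ _ _.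
- exact: nice_power_minus.
- move=> t /fproper_sub; rewrite nsetS => tj.
  have tj' : power (nset j) (t `\ j)%fset by rewrite /power /= fsubDset.
  have [jt|jt] := boolP (j \in t); last by left; move: tj'; rewrite mem_fsetD1.
  by right; exists (t `\ j)%fset => //; rewrite fsetD1K.
move=> t tj jt t0; rewrite -(fsetD1K jt).
have tj' : power (nset j) (t `\ j)%fset.
  by rewrite /power /= fsubDset -nsetS; exact: fproper_sub.
(* A proper subset of [nset j.+1] that contains [j] has fewer than [j] other elements. *)
apply: IH gA1 gB1 AB1 tj' _.
  have := fproper_ltn_card tj; rewrite (cardfsD1 j t) jt card_nset.
  rewrite add1n ltnS => tlj.
  exact: leq_trans tlj _.
by rewrite in_fsetD1 t0 andbT eq_sym -lt0n.
Qed.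

Lemma good_double n I A B :
  good n I A -> good n I B -> system_elem_sub C I A B ->
  good n.+1 (index_double n I) (pair_system n A B).
Proof.
move=> gA gB AB; have [nI _ _ _ _] := good_goodbase gA.
apply: good_pair (gA) (gB) (AB) (nice_double nI) _ _ => // s Js ns s0.
rewrite -(fsetD1K ns); apply: pair_stable gA gB AB _ _.
  by have [] := index_doubleP nI Js.
rewrite in_fsetD1 s0 andbT eq_sym -lt0n; exact: nice_gt0 nI.
Qed.

End Good.

(** * Loewenheim-Skolem *)

Lemma card_le_inj (U V : Type) (A : set U) (B : set V) (g : U -> V) :
  inj_into A B g -> A #<= B.
Proof.
move=> [gB ginj].
have : g @` A #= A.
  by apply: inj_card_eq => x y /set_mem Ax /set_mem Ay; exact: ginj.
rewrite card_eq_le => /andP[_ AgA].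
have gA : g @` A `<=` B by move=> _ [x Ax <-]; exact: gB.
exact: card_le_trans AgA (subset_card_le gA).
Qed.

(** * Coding of formulas in a type that absorbs its finite words *)

Section Coding.

Variables (L : language) (U : Type).
Variables (J : seq U -> U) (h : nat -> U) (r : relsym L -> U).
Hypotheses (J_inj : injective J) (h_inj : injective h) (r_inj : injective r).

(** The leading letter, from [h 0] to [h 4], tells the constructors apart. *)
Fixpoint code_form n (f : form L n) : U :=
  match f with
  | fFalse n => J [:: h 0; h n]
  | fEq n i j => J [:: h 1; h n; h i; h j]
  | fRel n R v => J [:: h 2, h n, r R & [seq h (v i) | i <- enum 'I_(arity R)]]
  | fImp n f g => J [:: h 3; h n; code_form f; code_form g]
  | fAll n f => J [:: h 4; h n; code_form f]
  end.

Lemma form_pair_inj n (f g : form L n) : existT (form L) n f = existT (form L) n g -> f = g.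
Proof.
by move=> E; have := projT2_eq E; rewrite (eq_irrelevance (projT1_eq E) erefl).
Qed.

(* The arity is coded too, which spares any case analysis on [g] at a fixed index. *)
Lemma code_form_inj n (f : form L n) n' (g : form L n') :
  code_form f = code_form g -> existT (form L) n f = existT (form L) n' g.
Proof.
elim: f n' g => {n} [n|n i j|n R v|n f IHf f' IHf'|n f IH] _
  [n'|n' i' j'|n' R' v'|n' g g'|n' g] /= /J_inj; try by move=> [] /h_inj.
- by case=> /h_inj->.
- case=> /h_inj E; case: n' / E i' j' => i' j' /h_inj/val_inj-> /h_inj/val_inj->.
  by [].
- case=> /h_inj E; case: n' / E v' => v' /r_inj E; case: R' / E v' => v'.
  move=> /eq_in_map E; congr existT; congr fRel; apply/funext => i.
  by apply/val_inj/h_inj/E; rewrite mem_enum.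
- case=> /h_inj E; case: n' / E g g' => g g' /IHf/form_pair_inj-> /IHf'/form_pair_inj->.
  by [].
- by case=> /h_inj E; case: n' / E g => g /IH/form_pair_inj->.
Qed.

End Coding.

(** * Skolem hulls *)

Section Hull.

Variables (L : language) (X : Type) (M : structure L X) (x0 : X).
Hypothesis Mx0 : dom M x0.

(** A Skolem function picks a counterexample to [f], as the only quantifier is universal; [x0] is
    the value when there is none. *)
Definition skolem n (f : form L n.+1) (e : 'I_n -> X) : X :=
  if pselect (exists a, dom M a /\ ~ sat M f (env_cons a e)) is left ex
  then sval (cid ex) else x0.

Lemma skolem_dom n (f : form L n.+1) e : dom M (skolem f e).
Proof. by rewrite /skolem; case: pselect => // ex; case: (cid ex) => a []. Qed.

Lemma skolemP n (f : form L n.+1) e :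
  sat M f (env_cons (skolem f e) e) -> forall a, dom M a -> sat M f (env_cons a e).
Proof.
rewrite /skolem; case: pselect => [ex|nex _ a Da]; first by case: (cid ex) => a [].
by apply: contrapT => nf; apply: nex; exists a.
Qed.

Inductive hull (E : set X) : set X :=
| hull_gen x : E x -> hull E x
| hull_skolem n (f : form L n.+1) e : (forall i, hull E (e i)) -> hull E (skolem f e).

Lemma hull_dom E : E `<=` dom M -> hull E `<=` dom M.
Proof. by move=> EM x [y /EM//|n f e _]; exact: skolem_dom. Qed.

Lemma hull_mono E F : E `<=` F -> hull E `<=` hull F.
Proof.
move=> EF x; elim=> {x} [x /EF|n f e _ IH]; first exact: hull_gen.
exact: hull_skolem.
Qed.

Lemma hull_bigcup (S : Type) (D : set S) (F : S -> set X) :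
  D !=set0 -> (forall a b, D a -> D b -> F a `<=` F b \/ F b `<=` F a) ->
  hull (\bigcup_(a in D) F a) `<=` \bigcup_(a in D) hull (F a).
Proof.
move=> [a0 Da0] Ftot x; elim=> {x} [x [a Da Fx]|n f e _ IH].
  by exists a => //; exact: hull_gen.
(* A Skolem function has finitely many arguments, so in a chain one index serves for all of them. *)
have [a Da he] : exists2 a, D a & forall i, i \in enum 'I_n -> hull (F a) (e i).
  elim: (enum 'I_n) => [|i s [a Da IHs]]; first by exists a0.
  have [b Db hb] := IH i.
  have [/hull_mono ab|/hull_mono ba] := Ftot _ _ Da Db.
    by exists b => // k; rewrite inE => /orP[/eqP->|/IHs/ab].
  by exists a => // k; rewrite inE => /orP[/eqP->|/IHs//]; exact: ba.
exists a => //; apply: hull_skolem => i; apply: he; exact: mem_enum.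
Qed.

(** Tarski-Vaught test: if the Skolem value, which lies in the hull, is no counterexample, then
    there is none in [M]. *)
Lemma hull_elem_sub E : E `<=` dom M -> elem_sub (induced M (hull E)) M.
Proof.
move=> /hull_dom EM; split=> // n f; elim: f => {n} //=.
- by move=> n f IHf g IHg e he; rewrite IHf // IHg.
- move=> n f IH e he; split=> [hf|Mf a ha].
    apply: skolemP; apply/IH; last by apply: hf; exact: hull_skolem.
    by apply: inside_cons => //; exact: hull_skolem.
  by apply/IH; [exact: inside_cons|apply: Mf; exact: EM].
Qed.

Section Count.

Variables (U : Type) (J : seq U -> U) (h : nat -> U) (r : relsym L -> U).
Hypotheses (J_inj : injective J) (h_inj : injective h) (r_inj : injective r).
Variables (G : Type) (c : G -> U) (g : G -> X).
Hypothesis c_inj : injective c.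

(* [rep u x]: [u] codes a Skolem term over the generators with value [x]. *)
Inductive rep : U -> X -> Prop :=
| rep_gen b : rep (J [:: h 0; c b]) (g b)
| rep_skolem n (f : form L n.+1) (u : 'I_n -> U) e : (forall i, rep (u i) (e i)) ->
    rep (J [:: h 1, code_form J h r f & [seq u i | i <- enum 'I_n]]) (skolem f e).

Lemma rep_functional u x y : rep u x -> rep u y -> x = y.
Proof.
move=> ux; elim: ux y => {u x} [b|n f u e _ IH] y uy.
  move E: (J _) uy => w uy; case: uy E => [b' /J_inj[/c_inj->]//|m k v d _].
  by move=> /J_inj[/h_inj].
move E: (J _) uy => w uy; case: uy E => [b' /J_inj[/h_inj]//|m k v d vd].
move=> /J_inj[/(code_form_inj J_inj h_inj r_inj) E].
have [mn] := projT1_eq E; case: m / mn k v d vd E => k v d vd.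
move=> /form_pair_inj-> /eq_in_map uv; congr skolem; apply/funext => i.
by apply: IH; rewrite uv ?mem_enum.
Qed.

(** An element may have many codes but a code has only one value, so choosing a code for each
    element is injective. *)
Lemma card_hull : hull (range g) #<= [set: U].
Proof.
have hrep x : hull (range g) x -> exists u, rep u x.
  elim=> {x} [_ [b _ <-]|n f e _ /choice[u ue]]; first by eexists; exact: rep_gen.
  by eexists; exact: rep_skolem ue.
pose w x := if pselect (exists u, rep u x) is left ex then sval (cid ex) else h 0.
apply: (card_le_inj (g := w)); split=> // x y /hrep ex /hrep ey.
rewrite /w; case: pselect => // ex'; case: pselect => // ey'.
case: (cid ex') => u ux; case: (cid ey') => v vy /= uv.
by rewrite uv in ux; exact: rep_functional ux vy.
Qed.

End Count.
End Hull.

(** * A complete theory is at least as large as its vocabulary and as the natural numbers *)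

Section TheorySize.

Variables (L : language) (T : set (form L 0)).
Hypothesis T_complete : forall f, T f \/ T (fNot f).

Definition decided (f : form L 0) : form L 0 := if pselect (T f) then f else fNot f.

Lemma decided_in f : T (decided f).
Proof. by rewrite /decided; case: pselect => //= nTf; case: (T_complete f). Qed.

(** Unaffected by an outer negation, so the symbol can be read off from [decided] whichever way the
    sentence is decided. *)
Fixpoint head_rel n (f : form L n) : option (relsym L) :=
  match f with
  | fRel _ R _ => Some R
  | fImp _ f _ => head_rel f
  | fAll _ f => head_rel f
  | _ => None
  end.

Fixpoint left_depth n (f : form L n) : nat :=
  if f is fImp _ f _ then (left_depth f).+1 else 0.

Definition theory_rel (R : relsym L) : form L 0 :=
  decided (fAll (fRel (fun _ : 'I_(arity R) => ord0))).

Lemma theory_rel_inj : injective theory_rel.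
Proof.
move=> R S /(congr1 (@head_rel 0)); rewrite /theory_rel /decided.
by case: pselect => ?; case: pselect => ? /= [].
Qed.

(** The number of negations is even, so one more, possibly added by [decided], disappears when the
    depth is halved. *)
Definition theory_nat (j : nat) : form L 0 := decided (iter j.*2 (@fNot L 0) fFalse).

Lemma theory_nat_inj : injective theory_nat.
Proof.
suff E j : (left_depth (theory_nat j))./2 = j by move=> i j ij; rewrite -(E i) ij.
have D k : left_depth (iter k (@fNot L 0) fFalse) = k by elim: k => //= k ->.
rewrite /theory_nat /decided; case: pselect => _ /=; rewrite D ?doubleK //.
by rewrite uphalf_double.
Qed.

End TheorySize.

(** * Order axioms, from unique least elements of sets with at most three elements *)

Section WellOrder.

Variables (O : Type) (le : rel O).
Hypothesis wo : well_order le.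

Lemma wo_refl x : le x x.
Proof.
have [|z [[zx zmin] _]] := wo (A := fun y => `[< y = x >]).
  by exists x; apply/asboolP.
by move: zx => /asboolP zx; rewrite -{1}zx; apply: zmin; apply/asboolP.
Qed.

Lemma wo_total x y : le x y \/ le y x.
Proof.
have [|z [[/asboolP[->|->] zmin] _]] := wo (A := fun z => `[< z = x \/ z = y >]).
- by exists x; apply/asboolP; left.
- by left; apply: zmin; apply/asboolP; right.
- by right; apply: zmin; apply/asboolP; left.
Qed.

Lemma wo_anti x y : le x y -> le y x -> x = y.
Proof.
move=> xy yx; have [|z [_ zu]] := wo (A := fun z => `[< z = x \/ z = y >]).
  by exists x; apply/asboolP; left.
rewrite -(zu x) ?(zu y) //; split; try (by apply/asboolP; auto).
  by move=> w /asboolP[->|->] //; exact: wo_refl.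
by move=> w /asboolP[->|->] //; exact: wo_refl.
Qed.

Lemma wo_trans x y w : le x y -> le y w -> le x w.
Proof.
move=> xy yw; have [|z [[/asboolP zA zmin] _]] :=
    wo (A := fun z => `[< [\/ z = x, z = y | z = w] >]).
  by exists x; apply/asboolP; apply: Or31.
have lez v : [\/ v = x, v = y | v = w] -> le z v by move=> ?; apply: zmin; exact/asboolP.
case: zA => E; rewrite E in lez.
- by apply: lez; apply: Or33.
- by rewrite (wo_anti xy (lez x _)) //; apply: Or31.
- by rewrite -(wo_anti yw (lez y _)) //; apply: Or32.
Qed.

Lemma slt_trans x y w : slt le x y -> slt le y w -> slt le x w.
Proof.
move=> [xy nxy] [yw nyw]; split; first exact: wo_trans yw.
by move=> xw; apply: nxy; apply: wo_anti => //; rewrite xw.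
Qed.

Lemma below_total x y : below le x `<=` below le y \/ below le y `<=` below le x.
Proof.
have sub u v : le u v -> below le u `<=` below le v.
  move=> uv w wu; have [<- //|nuv] := pselect (u = v).
  by apply: slt_trans wu _.
by have [/sub|/sub] := wo_total x y; [left|right].
Qed.

End WellOrder.

Lemma code_fset_inj (I : set {fset nat}) :
  injective (fun s : {s | I s} => CodeSeq.code (enum_fset (sval s))).
Proof.
move=> [s Is] [t It] /(can_inj CodeSeq.codeK) /= E.
by apply: eq_exist; apply: val_inj.
Qed.

(** * Hulls in the structure carried by a system *)

Section SystemHull.

Variables (L : language) (T : set (form L 0)) (X : Type) (C : structure L X).
Variables (I : set {fset nat}) (A : {fset nat} -> set X) (x0 : X).

Let N := system_structure C I A.

Lemma hull_system_elem_sub E : dom N x0 -> E `<=` dom N ->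
  system_elem_sub C I (fun s => A s `&` hull N x0 E) A.
Proof.
move=> Nx0 EN; apply: elem_sub_interpreted (hull_elem_sub Nx0 EN) _ _ _ _ => //.
- by move=> x [s _ []].
(* Every element of the hull lies in some part, so the universe of the trace system is the whole
   hull and a true formula defines it. *)
- move=> n i; apply: codef_ext (codef_not (codef_false _ _ n)) => e he.
    split=> _ //; have [s Is As] := hull_dom Nx0 EN (he i).
    by exists s => //; split=> //; exact: he.
  by split=> _ //; exact: (he i).
- move=> n [R|s] v; first exact: (codef_rel (induced N (hull N x0 E)) N v).
  have := codef_rel (induced N (hull N x0 E)) N (v : 'I_(@arity (system_language L I) (inr s)) -> _).
  apply: codef_ext => e he //=; split=> [As|[]//].
  by split=> //; exact: he.
Qed.

(** The type [S] is infinite because [T] is, so it absorbs its finite words. The symbols of [L] are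
    coded by sentences of [T], and the part predicates by natural numbers, an index being a finite
    set of naturals. *)
Lemma card_hull_system (Lam : Type) (D : set Lam) (q : Lam -> X) :
  (forall f, T f \/ T (fNot f)) -> hull N x0 (q @` D) #<= set_sum D T.
Proof.
move=> Tdec; pose S := set_sum D T.
pose inT f (Tf : T f) : S := SigSub (mem_set (Tf : S (inr f))).
have inT_inj f g Tf Tg : @inT f Tf = @inT g Tg -> f = g.
  by move=> /(congr1 val) /= [].
pose h j := inT _ (decided_in Tdec (iter j.*2 (@fNot L 0) fFalse)).
have h_inj : injective h by move=> i j /inT_inj; exact: (@theory_nat_inj L T).
have [J J_inj] := seq_inj h_inj.
pose rT R := inT _ (decided_in Tdec (fAll (fRel (fun _ : 'I_(arity R) => ord0)))).
have rT_inj : injective rT by move=> R R' /inT_inj; exact: (@theory_rel_inj L T).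
pose r (R : relsym (system_language L I)) :=
  match R with
  | inl R => J [:: h 0; rT R]
  | inr s => J [:: h 1; h (CodeSeq.code (enum_fset (sval s)))]
  end.
have r_inj : injective r.
  move=> [R|s] [R'|s'] /= /J_inj.
  - by move=> /(congr1 (nth (h 0) ^~ 1)) /rT_inj->.
  - by move=> /(congr1 (nth (h 0) ^~ 0)) /h_inj.
  - by move=> /(congr1 (nth (h 0) ^~ 0)) /h_inj.
  - by move=> /(congr1 (nth (h 0) ^~ 1)) /h_inj/code_fset_inj->.
pose c (b : D) : S := SigSub (mem_set (set_mem (valP b) : S (inl (val b)))).
have c_inj : injective c by move=> b b' /(congr1 val) /= [] /val_inj.
have -> : q @` D = range (fun b : D => q (val b)).
  apply/seteqP; split=> [_ [b Db <-]|_ [b _ <-]].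
    by exists (SigSub (mem_set Db)).
  by exists (val b) => //; exact: (set_mem (valP b)).
apply: card_le_trans (card_hull N x0 J_inj h_inj r_inj _ c_inj) _.
by have := card_setT S; rewrite card_eq_le => /andP[].
Qed.

End SystemHull.

Theorem theorem7p1
  (L : language) (P : relsym L) (T : set (form L 0))
  (X : Type) (C : structure L X) (K : Type)
  (hC : setting C P T K)
  (hstable : forall n : nat, n_stable C P T K n)
  (n : nat) (I : set {fset nat}) (A : {fset nat} -> set X)
  (hA : good_system C P T K n I A)
  (Lam : Type) (le : rel Lam)
  (hLam : initial_ordinal le (disjoint_union I A))
  (hT : card_lt T [set: Lam]) :
  exists B : Lam -> {fset nat} -> set X,
    [/\ (forall a s, I s -> B a s #<= set_sum (below le a) T),
        (forall s, I s ->
           (forall a b, slt le a b -> B a s `<=` B b s) /\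
           (forall d, limit_point le d ->
              B d s = \bigcup_(a in below le d) B a s)),
        (forall a, system_elem_sub C I (B a) A),
        (forall a, good_system C P T K n I (B a)) &
        (forall a b, slt le a b ->
           good_system C P T K n.+1 (index_double n I)
             (pair_system n (B a) (B b)))].
Proof.
have [Cdom CT _ _ _] := setting_monster hC.
have TM := setting_Morleyized hC.
have [[Y [M0 [[y My] M0T]]] Tdec] := setting_complete hC.
(* The theory decides whether anything exists, and its nonempty model [M0] forces the answer. *)
have [x Cx] : exists x, dom C x.
  apply: contrapT => Cne.
  have [/CT h|/M0T h] := Tdec (fNot (fAll fFalse)).
    by apply: h => x Cx; apply: Cne; exists x.
  by apply: h => /(_ y My).
have Pne : exists x, Defs.pred_set P C x.
  by apply: infinite_setN0; apply: (setting_infinite hC CT); exists x.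
have bA := good_goodbase hA.
have [x0 Ax0] := goodbase_nonempty Pne bA.
have [wo _ /card_bijP[p _]] := hLam.
pose N := system_structure C I A.
(* This lists the elements of the system along [Lam]; an element is repeated once for each part that
   contains it. *)
pose q a := (val (p (SigSub (mem_set (Logic.I : [set: Lam] a))))).2.
have qN a : dom N (q a).
  have /set_mem[Is As] := valP (p (SigSub (mem_set (Logic.I : [set: Lam] a)))).
  by exists (val (p (SigSub (mem_set (Logic.I : [set: Lam] a))))).1.
pose H a := hull N x0 (q @` below le a).
have qbN a : q @` below le a `<=` dom N by move=> _ [b _ <-].
have HM a b : slt le a b -> H a `<=` H b.
  move=> ab; apply: hull_mono => _ [c ca <-]; exists c => //.
  exact: slt_trans wo _ _ _ ca ab.
pose B a s := A s `&` H a.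
have BA a : system_elem_sub C I (B a) A by exact: hull_system_elem_sub.
have gB a : good_system C P T K n I (B a).
  exact: good_elem_sub Cdom CT TM Pne _ _ _ _ (BA a) hA.
exists B; split=> //.
- move=> a s Is; apply: card_le_trans (card_hull_system C I A x0 (below le a) q Tdec).
  by apply: subset_card_le => z [].
- move=> s Is; split=> [a b ab z [As Ha]|d [[a0 a0d] dlim]].
    by split=> //; exact: HM Ha.
  apply/seteqP; split=> [z [As Hd]|z [a ad [As Ha]]]; last first.
    by split=> //; exact: HM Ha.
  (* Since [d] is a limit, each [b] below [d] is below some [c] below [d], so the generators at [d]
     are the union of those at earlier points. *)
  have [|||a ad Ha] := @hull_bigcup _ _ N x0 _ (below le d) (fun a => q @` below le a) _ _ z.
  + by exists a0.
  + move=> a b _ _.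
    by have [ab|ba] := below_total wo a b; [left|right]; exact: image_subset.
  + apply: hull_mono Hd => _ [b bd <-]; have [c [bc cd]] := dlim _ bd.
    by exists c => //; exists b.
  by exists a.
- move=> a b ab; apply: good_double => //.
  (* Both hulls are elementary in [A] and they are nested, so the smaller is elementary in the
     larger. *)
  apply: elem_sub_factor (BA a) (BA b) => z [s Is [As Ha]].
  by exists s => //; split=> //; exact: HM Ha.
Qed.
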